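(* Let $P$ be a Dyck path of size $n$. Then $\widehat{RSK}^{-1}(P)=\mathrm{DT}(P)$ as a $321$-avoiding permutation; that is, the permutation $\mathrm{DT}(P)$ obtained from the maximal cover-inclusive Dyck tiling above $P$ is the $321$-avoiding permutation $w\in S_n$ with $\widehat{RSK}(w)=P$.
   Context: A Dyck path of size $n$ is a lattice path from $(0,0)$ to $(n,n)$ with steps $U=(0,1)$, $R=(1,0)$, weakly above $y=x$, identified with its word of length $2n$. $\widehat{RSK}$: for a $321$-avoiding $w\in S_n$ let $(A,B)$ be its (insertion, recording) tableau pair under Robinson--Schensted row insertion (at most two rows). $\widehat{RSK}(w)$ is the Dyck path whose $i$-th step ($1\le i\le n$) is $U$ if $i$ is in the first row of $A$ and $R$ if in the second, and whose $(2n+1-i)$-th step is $R$ if $i$ is in the first row of $B$ and $U$ if in the second. It is a bijection from $321$-avoiding permutations to Dyck paths. Dyck tilings: a Dyck tile is a ribbon (connected skew shape without $2\times2$ square) of unit boxes whose centres, read from bottom left to top right, form a Dyck path (possibly of size $0$, i.e. a single box). A Dyck tiling above $\lambda$ is a tiling by Dyck tiles of the region above the Dyck path $\lambda$ and below the top path $U^nR^n$. It is cover-inclusive if, whenever a tile $d_1$ is moved by one unit in the southeast direction (translation by $(1,-1)$), the moved tile lies below $\lambda$ or is contained in another tile $d_2$ of the tiling (possibly of the same size). A cover-inclusive Dyck tiling is maximal if its tiles have maximum sizes, i.e. no tile can be enlarged: there is no other cover-inclusive tiling of the same region such that every tile of the given one is contained in a tile of the other. The map $\mathrm{DT}$: let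 $T$ be the maximal cover-inclusive Dyck tiling above $\lambda=P$. Order its tiles $d_1,\dots,d_r$ so that they can be removed one by one from bottom to top: with $\lambda_0=\lambda$, $d_p$ lies just above $\lambda_{p-1}$, and $\lambda_p$ is the lowest path above $\lambda_{p-1}$ and $d_p$. If the south-most edge of $d_p$ (bottom edge of its bottom-left box) is the $i_p$-th step of $\lambda_{p-1}$ and its rightmost edge (right edge of its top-right box) is the $j_p$-th step of $\lambda_{p-1}$, associate to $d_p$ the transposition $t_{i_p,j_p}$. Start with the non-crossing perfect matching of $[1,2n]$ given by $P$ (each $U$-position is matched with an $R$-position as for matching parentheses) and, for $p=1,2,\dots,r$ in this order, exchange the integers $i_p$ and $j_p$ in the pairs. In the resulting matching each of $n+1,\dots,2n$ is paired with an element of $[1,n]$; $\mathrm{DT}(P)=w_1\cdots w_n$ is defined by letting $w_{n+1-i}$ be the partner of $n+i$, for $1\le i\le n$. *)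

(* Defs.v *)
(* Mathematical Components. *)
From mathcomp Require Import all_boot all_fingroup.

Set Implicit Arguments.
Unset Strict Implicit.
Unset Printing Implicit Defensive.

(* ---------- Lattice paths ---------- *)

Definition step := bool.
Definition U : step := true.
Definition R : step := false.

(* The point (x, y) reached from (0, 0) after the first k steps of s. *)
Definition pos (s : seq step) (k : nat) : nat * nat :=
  (count_mem R (take k s), count_mem U (take k s)).

(* Weakly above y = x and ending on y = x; pos is constant for k >= size s. *)
Definition dyck_word (s : seq step) : Prop :=
  count_mem R s = count_mem U s /\ forall k, (pos s k).1 <= (pos s k).2.

Definition lattice_path (n : nat) (s : seq step) : Prop :=
  count_mem U s = n /\ count_mem R s = n.

Definition dyck_path (n : nat) (s : seq step) : Prop :=
  lattice_path n s /\ dyck_word s.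

(* ---------- 321-avoiding permutations and Robinson-Schensted ---------- *)

(* w : 'S_n acts on {0, .., n-1}; the one-line word below is shifted by 1 so
   that tableaux have entries 1, .., n. *)
Definition one_line n (w : 'S_n) : seq nat := [seq (val (w i)).+1 | i <- enum 'I_n].

Definition avoids321 n (w : 'S_n) : Prop :=
  forall i j k : 'I_n, i < j -> j < k -> ~ (w i > w j /\ w j > w k).

(* A tableau is the list of its rows, from the first one. Row insertion returns
   the new tableau and the (0-based) index of the row of the new cell. *)
Fixpoint row_insert (x : nat) (t : seq (seq nat)) : seq (seq nat) * nat :=
  if t is r :: t' then
    let k := find (fun y => x < y) r in
    if k < size r then
      let: (t'', h) := row_insert (nth 0 r k) t' in (set_nth 0 r k x :: t'', h.+1)
    else (rcons r x :: t', 0)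
  else ([:: [:: x]], 0).

Definition RS_step (AB : seq (seq nat) * seq (seq nat)) (ix : nat * nat) :=
  let: (A', h) := row_insert ix.2 AB.1 in
  (A', set_nth [::] AB.2 h (rcons (nth [::] AB.2 h) ix.1)).

Definition RS (s : seq nat) : seq (seq nat) * seq (seq nat) :=
  foldl RS_step ([::], [::]) (zip (iota 1 (size s)) s).

Definition first_row (t : seq (seq nat)) : seq nat := nth [::] t 0.

(* Entries outside the first row are in the second one when w avoids 321. *)
Definition RSKhat n (w : 'S_n) : seq step :=
  let: (A, B) := RS (one_line w) in
  [seq if i \in first_row A then U else R | i <- iota 1 n]
  ++ rev [seq if i \in first_row B then R else U | i <- iota 1 n].

(* ---------- Boxes and regions ---------- *)

(* The box (x, y) is the unit square with south-west corner (x, y). *)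
Definition box n : finType := ('I_n * 'I_n)%type.
Definition corner n (b : box n) : nat * nat := (val b.1, val b.2).

(* The i-th step of s (0-based) is the step c starting at the point p. *)
Definition is_step (s : seq step) (i : nat) (c : step) (p : nat * nat) : bool :=
  [&& i < size s, nth U s i == c & pos s i == p].

(* Boxes lying above the horizontal step of s in their column. All the boxes of
   the n x n square lie below the top path U^n R^n. *)
Definition above n (s : seq step) : {set box n} :=
  [set b : box n | [exists i : 'I_(size s),
     [&& nth U s i == R, (pos s i).1 == b.1 & (pos s i).2 <= b.2]]].

(* ---------- Dyck tilings ---------- *)

(* Centres of the boxes of a ribbon, listed from bottom left to top right, are
   the successive points of a translated path with up and right steps (and the
   boxes centred on such a path always form a ribbon); this path has to be a
   Dyck path, possibly empty. *)
Definition dyck_tile n (d : {set box n}) : Prop :=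
  exists (D : seq step) (x y : nat) (bs : seq (box n)),
    [/\ dyck_word D,
        [seq corner b | b <- bs]
          = [seq (x + (pos D k).1, y + (pos D k).2) | k <- iota 0 (size D).+1]
      & d = [set b in bs]].

Definition dyck_tiling n (P : seq step) (T : {set {set box n}}) : Prop :=
  partition T (above n P) /\ forall d, d \in T -> dyck_tile d.

(* Translation by (1, -1). When P is a Dyck path of size n the boxes above P
   satisfy x < y, so none of them leaves the n x n square. *)
Definition shiftSE n (d : {set box n}) : {set box n} :=
  [set c : box n | [exists b in d, (c.1 == b.1.+1 :> nat) && (c.2.+1 == b.2 :> nat)]].

Definition cover_inclusive n (P : seq step) (T : {set {set box n}}) : Prop :=
  forall d1, d1 \in T ->
    [disjoint shiftSE d1 & above n P] \/
    exists2 d2, d2 \in T & shiftSE d1 \subset d2.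

Definition maximal_tiling n (P : seq step) (T : {set {set box n}}) : Prop :=
  [/\ dyck_tiling P T, cover_inclusive P T
    & forall S : {set {set box n}}, dyck_tiling P S -> cover_inclusive P S ->
        (forall d, d \in T -> exists2 e, e \in S & d \subset e) -> S = T].

(* ---------- The map DT ---------- *)

(* Nothing between the path s and d, i.e. no box outside d which is above s and
   weakly south-east of a box of d. *)
Definition just_above n (s : seq step) (d : {set box n}) : Prop :=
  d \subset above n s /\
  forall b c : box n, c \in d -> b \in above n s ->
    c.1 <= b.1 -> b.2 <= c.2 -> b \in d.

Definition path_above n (s : seq step) (d : {set box n}) (s' : seq step) : Prop :=
  [/\ lattice_path n s', above n s' \subset above n s & [disjoint d & above n s']].

Definition lowest_path_above n (s : seq step) (d : {set box n}) (s' : seq step) : Prop :=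
  path_above s d s' /\
  forall s'', path_above s d s'' -> above n s'' \subset above n s'.

Definition bottom_left n (d : {set box n}) (b : box n) : Prop :=
  b \in d /\ forall c : box n, c \in d -> b.1 <= c.1 /\ b.2 <= c.2.

Definition top_right n (d : {set box n}) (b : box n) : Prop :=
  b \in d /\ forall c : box n, c \in d -> c.1 <= b.1 /\ c.2 <= b.2.

(* The south-most edge of d is step i of s, its rightmost edge is step j of s. *)
Definition tile_steps n (s : seq step) (d : {set box n}) (i j : nat) : Prop :=
  exists b e : box n,
    [/\ bottom_left d b, top_right d e,
        is_step s i R (val b.1, val b.2) & is_step s j U ((val e.1).+1, val e.2)].

(* Perfect matchings of {1, .., 2n} are fixed-point-free involutions of
   'I_(n + n), the position p being represented by the ordinal of value p - 1. *)
Definition paren_matched (P : seq step) (i j : nat) : Prop :=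
  [/\ i < j, nth R P i = U, nth U P j = R & dyck_word (drop i.+1 (take j P))].

Definition paren_matching n (P : seq step) (m : {perm 'I_(n + n)}) : Prop :=
  forall i : 'I_(n + n), paren_matched P i (m i) \/ paren_matched P (m i) i.

(* m ^ tperm i j is a conjugate: it exchanges i and j in the pairs of m. *)
Inductive DT_run n : seq step -> {perm 'I_(n + n)} -> seq {set box n} ->
    {perm 'I_(n + n)} -> Prop :=
| DT_nil s m : DT_run s m [::] m
| DT_cons s m d ds s' (i j : 'I_(n + n)) m' :
    just_above s d -> lowest_path_above s d s' -> tile_steps s d i j ->
    DT_run s' (m ^ tperm i j)%g ds m' ->
    DT_run s m (d :: ds) m'.

(* w_(n+1-p) is the partner of n + p, for p = k + 1 in 1, .., n. *)
Definition reads_off n (m : {perm 'I_(n + n)}) (w : 'S_n) : Prop :=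
  forall k : 'I_n, m (rshift n k) = lshift n (w (rev_ord k)).

(* w is obtained from P for some maximal tiling and some removal order. *)
Definition DT n (P : seq step) (w : 'S_n) : Prop :=
  exists (T : {set {set box n}}) (ds : seq {set box n}) (m0 m : {perm 'I_(n + n)}),
    [/\ maximal_tiling P T, perm_eq ds (enum T),
        paren_matching P m0, DT_run P m0 ds m & reads_off m w].

(* Main.v *)
Require Import Defs.
From mathcomp Require Import all_boot all_fingroup.
From mathcomp Require Import zify.

Set Implicit Arguments.
Unset Strict Implicit.
Unset Printing Implicit Defensive.

(** Both constructions obey one recursion, recorded by [code]. Let [U R] be the
    last peak of [P] that starts in the first half of [P], after [p] steps.
    Erasing it leaves a path [P'], which is the path of the permutation [w']
    obtained from [w] by deleting the last entry, whose value is [p] (counting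
    from 0), and standardizing. Since the peak can be located in [P], this
    determines [w].

    For row insertion only the first rows matter. When the last entry of [w] is
    inserted, it bumps the first letter [U] of the upper half of [P'] beyond the
    first [p] letters, if there is one. That [w] avoids 321 means that these
    further letters read [R^a U^b] ([bumped_above], [inversion_bumps]), and then
    the effect on the path is exactly the insertion of a peak ([RSKhat_lift]).

    For tilings, cut the region above [P] into layers by counting how often a
    box can be moved south-east inside the region. The boxes of layer [k] follow
    the word of [P] strictly between its [k]-th step [R] from the left and its
    [k]-th step [U] from the right (from [k = 0]). A tile of a cover-inclusive
    tiling stays in one layer, so it is a Dyck factor of the word of the layer;
    and the word of a layer is a factor of that of the layer below. Hence the
    maximal Dyck factors of all the layers form a cover-inclusive tiling that
    every other one refines, and this is the unique maximal tiling
    ([maximal_tiling_unique]). The maximal Dyck factors of a word are separated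
    by its unmatched steps, first steps [R] and then steps [U]; a tile between
    consecutive separators gives the transposition of these two positions.

    Removing a tile exchanges an [R] and a [U] of the path, and two tiles that
    can be removed at the same time concern disjoint pairs of steps. So the
    order of removal is irrelevant ([clears_act]), and the layers may be removed
    one after the other.

    Finally, inserting a peak in [P'] changes the layers in a simple way
    ([peak_layer]): a layer that starts before the peak keeps its separators,
    and one that starts after it gets a new first separator, which is the place
    where the [R] of the peak has arrived. The last tile of such a layer is a
    single box and moves this [R] by one step. So the [R] of the peak travels to
    the middle of the path while its [U] stays at [p] and all other positions
    move as they do for [P'] ([peak_moves]): the last entry is [p] and the
    others are those of [w'] ([code_layers]). *)

(** * Words and levels *)

Notation nR s t := (pos s t).1.
Notation nU s t := (pos s t).2.

Lemma nRS s t : t < size s -> nR s t.+1 = nR s t + (nth U s t == R).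
Proof.
by move=> lt_ts; rewrite /= (take_nth U) // -cats1 count_cat /= addn0.
Qed.

Lemma nUS s t : t < size s -> nU s t.+1 = nU s t + (nth U s t == U).
Proof.
by move=> lt_ts; rewrite /= (take_nth U) // -cats1 count_cat /= addn0.
Qed.

Lemma count_step (s : seq step) : count_mem R s + count_mem U s = size s.
Proof. by elim: s => //= -[] s; rewrite /R /U /=; lia. Qed.

Lemma nRUE s t : t <= size s -> nR s t + nU s t = t.
Proof. by move=> le_ts; rewrite /= count_step size_takel. Qed.

Lemma nR_size s : nR s (size s) = count_mem R s.
Proof. by rewrite /= take_size. Qed.

Lemma nU_size s : nU s (size s) = count_mem U s.
Proof. by rewrite /= take_size. Qed.

Lemma count_take_le (a : pred step) s t t' :
  t <= t' -> count a (take t s) <= count a (take t' s).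
Proof.
move=> le_tt'; rewrite -(subnKC le_tt') takeD count_cat; exact: leq_addr.
Qed.

Lemma nR_le s t t' : t <= t' -> nR s t <= nR s t'.
Proof. exact: count_take_le. Qed.

Lemma nU_le s t t' : t <= t' -> nU s t <= nU s t'.
Proof. exact: count_take_le. Qed.

Lemma nR_le_all s t : nR s t <= count_mem R s.
Proof. by rewrite -{2}(cat_take_drop t s) count_cat leq_addr. Qed.

Lemma nU_le_all s t : nU s t <= count_mem U s.
Proof. by rewrite -{2}(cat_take_drop t s) count_cat leq_addr. Qed.

Lemma lattice_path_size n s : lattice_path n s -> size s = n + n.
Proof. by case=> cU cR; rewrite -count_step cU cR. Qed.

(** The shift by [size s] keeps the truncated subtraction exact. *)
Definition lev (s : seq step) t := nU s t + size s - nR s t.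

Lemma levS s t : t < size s ->
  if nth U s t == U then lev s t.+1 = (lev s t).+1
  else lev s t = (lev s t.+1).+1.
Proof.
move=> lt_ts; rewrite /lev nRS // nUS //.
have := nRUE (ltnW lt_ts).
case: (nth U s t) => /=; lia.
Qed.

Lemma levU s t : t < size s -> nth U s t = U -> lev s t.+1 = (lev s t).+1.
Proof. by move=> lt_ts e; have := levS lt_ts; rewrite e. Qed.

Lemma levR s t : t < size s -> nth U s t = R -> lev s t = (lev s t.+1).+1.
Proof. by move=> lt_ts e; have := levS lt_ts; rewrite e. Qed.

(** The factor of [s] between the points [a] and [b] is a Dyck word. *)
Definition dint s a b :=
  [&& a <= b, lev s a == lev s b &
      all (fun t => lev s a <= lev s t) (iota a (b - a).+1)].

Lemma dintP s a b :
  reflect [/\ a <= b, lev s a = lev s b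
            & forall t, a <= t <= b -> lev s a <= lev s t] (dint s a b).
Proof.
apply: (iffP and3P) => [[ab /eqP e /allP h]|[ab e h]]; split=> //.
- by move=> t ht; apply: h; rewrite mem_iota; lia.
- by rewrite e.
- by apply/allP => t; rewrite mem_iota => ht; apply: h; lia.
Qed.

Lemma dint_refl s a : dint s a a.
Proof.
apply/dintP; split=> // t ht.
by have -> : t = a by lia.
Qed.

Lemma pos_factor s a b j : a <= b -> b <= size s -> j <= b - a ->
  nR s (a + j) = nR s a + nR (drop a (take b s)) j /\
  nU s (a + j) = nU s a + nU (drop a (take b s)) j.
Proof.
move=> ab bs jb.
have -> : take b s = take a s ++ drop a (take b s).
  by rewrite -{1}(cat_take_drop a (take b s)) take_takel.
rewrite drop_size_cat ?size_takel; try lia.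
have e : take (a + j) s = take a s ++ take j (drop a (take b s)).
  rewrite take_drop take_takel ?(addnC j); last lia.
  by rewrite -{1}(cat_take_drop a (take (a + j) s)) take_takel ?leq_addr.
by rewrite /= e !count_cat.
Qed.

Lemma dyck_word_factor s a b : a <= b -> b <= size s ->
  dyck_word (drop a (take b s)) <-> dint s a b.
Proof.
move=> ab bs; set D := drop a (take b s).
have szD : size D = b - a by rewrite size_drop size_takel.
have F j : j <= b - a -> nR s (a + j) = nR s a + nR D j /\
  nU s (a + j) = nU s a + nU D j by exact: pos_factor.
have L t : t <= size s -> nR s t + nU s t = t by exact: nRUE.
have eb : a + (b - a) = b by lia.
split=> [[cD hD]|/dintP [_ e h]].
- apply/dintP; split=> //.
    have [] := F (b - a) (leqnn _).
    rewrite eb -szD nR_size nU_size cD /lev.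
    by have := L a ltac:(lia); have := L b bs; lia.
  move=> t /andP [at_ tb].
  have [] := F (t - a) ltac:(lia).
  have -> : a + (t - a) = t by lia.
  rewrite /lev; have := hD (t - a).
  by have := L a ltac:(lia); have := L t ltac:(lia); lia.
have H j : j <= b - a -> nR D j <= nU D j.
  move=> jb; have [] := F j jb; have := h (a + j) ltac:(lia).
  rewrite /lev; have := L a ltac:(lia); have := L (a + j) ltac:(lia); lia.
split.
  have [] := F (b - a) (leqnn _); move: e.
  rewrite eb -szD nR_size nU_size /lev.
  by have := L a ltac:(lia); have := L b bs; lia.
move=> k; case: (leqP k (b - a)) => [|lt]; first exact: H.
have := H _ (leqnn _); rewrite /= -szD take_size take_oversize // szD; lia.
Qed.

Lemma paren_matchedP s p q : q < size s ->
  paren_matched s p q <->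
  [/\ p < q, nth U s p = U, nth U s q = R & dint s p.+1 q].
Proof.
move=> qs.
have eR i : i < size s -> nth R s i = nth U s i by exact: set_nth_default.
split=> -[pq ep eq h].
  split=> //; first by rewrite -eR //; lia.
  exact/(dyck_word_factor pq (ltnW qs)).
split=> //; first by rewrite eR //; lia.
exact/(dyck_word_factor pq (ltnW qs)).
Qed.

(** * Inserting a peak *)

(** Deleting the peak [U R] at position [p0] identifies the points of a word
    with those of the shortened word; the summit of the peak goes to its foot. *)
Definition unpeak p0 t := if t <= p0 then t else if t == p0.+1 then p0 else t.-2.

Definition skip2 p0 p := if p < p0 then p else p.+2.

Section PeakInsertion.

Variables F X : seq step.
Let p0 := size F.
Let P := F ++ U :: R :: X.
Let P' := F ++ X.

Lemma size_peak : size P = (size P').+2.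
Proof. by rewrite !size_cat /= !addnS. Qed.

Lemma count_peak (a : pred step) t :
  count a (take t P) = count a (take (unpeak p0 t) P')
    + (p0 < t) * a U + (p0.+1 < t) * a R.
Proof.
rewrite /unpeak /P /P' !take_cat -/p0.
case: (ltngtP t p0) => [lt|gt|->] /=.
- by rewrite lt; lia.
- case: eqP => [->|ne].
    rewrite ltnn subSnn subnn take0 !count_cat /=; lia.
  have -> : t.-2 < p0 = false by lia.
  have -> : t - p0 = (t.-2 - p0).+2 by lia.
  rewrite !count_cat /=; lia.
- rewrite ltnn subnn !take0; lia.
Qed.

Lemma nR_peak t : nR P t = nR P' (unpeak p0 t) + (p0.+1 < t).
Proof. by rewrite /= count_peak /= muln0 muln1 addn0. Qed.

Lemma nU_peak t : nU P t = nU P' (unpeak p0 t) + (p0 < t).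
Proof. by rewrite /= count_peak /= muln0 muln1 addn0. Qed.

Lemma lev_peak t : t <= size P ->
  lev P t = lev P' (unpeak p0 t) + 2 + (t == p0.+1).
Proof.
move=> tP; rewrite /lev nR_peak nU_peak size_peak.
have bt : unpeak p0 t <= size P'.
  rewrite /unpeak; move: tP; rewrite size_peak /P' size_cat -/p0.
  by case: ifP => ?; [lia | case: ifP; lia].
have := nRUE bt; have := nRUE tP; rewrite nR_peak nU_peak.
move: bt tP; rewrite size_peak; lia.
Qed.

Lemma nth_peak x p : nth x P (skip2 p0 p) = nth x P' p.
Proof.
rewrite /skip2 !nth_cat -/p0; case: (ltnP p p0) => [->//|le].
have -> : p.+2 < p0 = false by lia.
by have -> : p.+2 - p0 = (p - p0).+2 by lia.
Qed.

Lemma nth_peakU x : nth x P p0 = U.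
Proof. by rewrite nth_cat ltnn subnn. Qed.

Lemma nth_peakR x : nth x P p0.+1 = R.
Proof. by rewrite nth_cat ltnNge leqnSn /= subSnn. Qed.

Lemma dint_peak p q : p < q -> q < size P' ->
  dint P' p.+1 q = dint P (skip2 p0 p).+1 (skip2 p0 q).
Proof.
move=> pq qs; have szP := size_peak.
have szP0 : p0 <= size P' by rewrite size_cat leq_addr.
have sq : skip2 p0 q <= size P by rewrite /skip2; case: ifP; lia.
have sp : (skip2 p0 p).+1 <= skip2 p0 q.
  by rewrite /skip2; case: (ltnP p); case: (ltnP q); lia.
have bp : unpeak p0 (skip2 p0 p).+1 = p.+1 /\ (skip2 p0 p).+1 == p0.+1 = false.
  by rewrite /unpeak /skip2; case: (ltnP p) => h; rewrite ?h; repeat case: ifP; lia.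
have bq : unpeak p0 (skip2 p0 q) = q /\ skip2 p0 q == p0.+1 = false.
  by rewrite /unpeak /skip2; case: (ltnP q) => h; rewrite ?h; repeat case: ifP; lia.
have lp := @lev_peak (skip2 p0 p).+1 ltac:(lia).
have lq := @lev_peak (skip2 p0 q) sq.
rewrite bp.1 bp.2 in lp; rewrite bq.1 bq.2 in lq.
apply/dintP/dintP => -[_ e h]; split; try lia.
- move=> t ht; have := @lev_peak t ltac:(lia); have := h (unpeak p0 t).
  have : p < unpeak p0 t <= q; last lia.
  by move: ht; rewrite /unpeak /skip2; repeat case: ifP; lia.
- move=> t ht.
  pose t' := if t <= p0 then t else t.+2.
  have bt : unpeak p0 t' = t /\ t' == p0.+1 = false.
    by rewrite /unpeak /t'; case: (leqP t); repeat case: ifP; lia.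
  have ht' : (skip2 p0 p) < t' <= skip2 p0 q.
    move: ht; rewrite /t' /skip2; case: (leqP t p0) => ?;
    by case: (ltnP p p0) => ?; case: (ltnP q p0) => ?; lia.
  clearbody t'; have := @lev_peak t' ltac:(lia); rewrite bt.1 bt.2; have := h t'; lia.
Qed.

Lemma dyck_word_peak : dyck_word P <-> dyck_word P'.
Proof.
have cR : count_mem R P = (count_mem R P').+1 by rewrite !count_cat /= addnS.
have cU : count_mem U P = (count_mem U P').+1 by rewrite !count_cat /= addnS.
rewrite /dyck_word cR cU; split=> -[c h]; split; try lia.
- move=> k; pose t := if k <= p0 then k else k.+2.
  have := h t; rewrite nR_peak nU_peak.
  have -> : unpeak p0 t = k.
    by rewrite /unpeak /t; case: (leqP k); repeat case: ifP; lia.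
  by rewrite /t; case: ifP; lia.
- by move=> k; rewrite nR_peak nU_peak; have := h (unpeak p0 k); lia.
Qed.

Lemma dyck_path_peak n : dyck_path n.+1 P <-> dyck_path n P'.
Proof.
rewrite /dyck_path dyck_word_peak /lattice_path !count_cat /=.
by split=> -[[c1 c2] h]; split=> //; lia.
Qed.

End PeakInsertion.

(** The permutations are built from their last entry: when [w] ends with the
    value [p], its path has a peak starting after [p] steps, and erasing both
    leaves a smaller permutation with its path. The condition on the letters
    following the peak says that it is the last peak that starts in the first
    half of the path, and this is what makes the last entry readable. *)
Fixpoint code n : seq step -> 'S_n -> Prop :=
  match n return seq step -> 'S_n -> Prop with
  | 0 => fun P w => P = [::]
  | m.+1 => fun P w => exists F a b S (w' : 'S_m),
      [/\ size F + a + b = m, code (F ++ nseq a R ++ nseq b U ++ S) w',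
          P = F ++ U :: R :: nseq a R ++ nseq b U ++ S
        & w = lift_perm ord_max (inord (size F)) w']
  end.

Lemma last_peak (t : seq step) : R \in t -> nth U t 0 = U ->
  exists F a b, t = F ++ U :: R :: nseq a R ++ nseq b U.
Proof.
elim/last_ind: t => // t x IH.
case: t IH => [|y t] IH; first by case: x.
have h0 : nth U (rcons (y :: t) x) 0 = nth U (y :: t) 0 by [].
rewrite h0 => Rt e; move: Rt; case: x {h0} => Rt.
  have {}Rt : R \in y :: t by move: Rt; rewrite mem_rcons inE.
  have [F [a [b ->]]] := IH Rt e; exists F, a, b.+1.
  have -> : nseq b.+1 U = rcons (nseq b U) U by elim: (b) => //= k <-.
  by rewrite rcons_cat /= rcons_cat.
case lz: (last y t).
  exists (belast y t), 0, 0.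
  by rewrite lastI lz -cats1 -cats1 -catA.
have {}Rt : R \in y :: t.
  by have := mem_last y t; rewrite lz.
have [F [a [b eF]]] := IH Rt e; exists F, a.+1, 0.
have b0 : b = 0.
  case: b eF => // b eF.
  have : last U (y :: t) = U.
    by rewrite eF !last_cat /= last_cat /=; elim: {eF} b.
  by rewrite /= lz.
rewrite eF b0 !cats0 -cats1 -catA /=.
by congr (_ ++ [:: _, _ & _]); elim: (a) => //= k ->.
Qed.


Lemma code_dyck_path n P (w : 'S_n) : code P w -> dyck_path n P.
Proof.
elim: n P w => [|n IH] P w /=.
  by move=> ->; split=> //; split=> // -[].
move=> [F [a [b [S [w' [_ cw -> _]]]]]].
by apply/dyck_path_peak; apply: IH cw.
Qed.

Lemma code_exists n P : dyck_path n P -> exists w : 'S_n, code P w.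
Proof.
elim: n P => [|n IH] P dP.
  exists 1%g; have [[cU cR] _] := dP.
  by apply: size0nil; rewrite -count_step cU cR.
have [[cU cR] [_ hP]] := dP.
have szP : size P = n.+1 + n.+1 by rewrite -count_step cU cR.
(* The first half and one more step contain a letter [R], hence a peak. *)
have Rt : R \in take n.+2 P.
  rewrite -has_pred1 has_count; have := @nRUE P n.+2 ltac:(lia).
  have := nU_le_all P n.+2; rewrite cU /=; lia.
have P0 : nth U (take n.+2 P) 0 = U.
  rewrite nth_take //.
  by have := hP 1; rewrite nRS ?nUS ?szP //= !take0 /=; case: nth.
have [F [a [b et]]] := last_peak Rt P0.
have eP : P = F ++ U :: R :: nseq a R ++ nseq b U ++ drop n.+2 P.
  by rewrite -{1}(cat_take_drop n.+2 P) et -catA /= -catA.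
have sz : size F + a + b = n.
  have := congr1 size et; rewrite size_takel ?szP; last lia.
  rewrite size_cat /= size_cat !size_nseq; lia.
have [w' cw'] : exists w' : 'S_n, code (F ++ nseq a R ++ nseq b U ++ drop n.+2 P) w'.
  by apply: IH; apply/dyck_path_peak; rewrite -eP.
exists (lift_perm ord_max (inord (size F)) w') => /=.
by exists F, a, b, (drop n.+2 P), w'.
Qed.

Lemma last_peak_le F1 a1 b1 S1 F2 a2 b2 S2 :
  F1 ++ U :: R :: nseq a1 R ++ nseq b1 U ++ S1
    = F2 ++ U :: R :: nseq a2 R ++ nseq b2 U ++ S2 ->
  size F1 + a1 + b1 = size F2 + a2 + b2 -> size F2 <= size F1.
Proof.
move=> e sz; rewrite leqNgt; apply/negP => lt.
pose s := F1 ++ U :: R :: nseq a1 R ++ nseq b1 U ++ S1.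
have sU : nth U s (size F2) = U by rewrite /s e nth_peakU.
have sR : nth U s (size F2).+1 = R by rewrite /s e nth_peakR.
have tail j : nth U s (size F1 + j.+2)
    = if j < a1 then R else if j < a1 + b1 then U else nth U S1 (j - a1 - b1).
  rewrite /s nth_cat ltnNge leq_addr addKn /= nth_cat size_nseq nth_nseq.
  case: ltnP => // aj; rewrite nth_cat size_nseq nth_nseq.
  by case: (ltnP (j - a1)) => h; case: ltnP => h' //; lia.
case: (ltngtP (size F2) (size F1).+1) => h; first by lia.
  have e2 : size F2 = size F1 + (size F2 - size F1 - 2).+2 by lia.
  move: sU sR; rewrite e2 -addnS !tail.
  case: ltnP => // ? _; case: ltnP => ?; first by lia.
  by case: ltnP => //; lia.
by move: sU; rewrite h nth_peakR.
Qed.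

(** The last peak that starts in the first half can be located, so the path
    determines the last entry, and what remains by induction. *)
Lemma code_inj n P (w1 w2 : 'S_n) : code P w1 -> code P w2 -> w1 = w2.
Proof.
elim: n P w1 w2 => [|n IH] P w1 w2; first by move=> *; apply/permP => -[].
move=> [F1 [a1 [b1 [S1 [v1 [sz1 c1 -> ->]]]]]].
move=> [F2 [a2 [b2 [S2 [v2 [sz2 c2 e ->]]]]]].
have szF : size F1 = size F2.
  apply/eqP; rewrite eqn_leq (last_peak_le e) ?(last_peak_le (esym e)) //; lia.
have /eqP := e; rewrite eqseq_cat // => /andP [/eqP eF /eqP [eX]].
by rewrite szF; congr lift_perm; apply: IH c1 _; rewrite eF eX.
Qed.

(** * First rows under row insertion *)

(** The first row of the insertion tableau evolves on its own; the row that it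
    feeds never has to be known. *)
Definition row1 (r : seq nat) x :=
  let k := find (fun y => x < y) r in
  if k < size r then set_nth 0 r k x else rcons r x.

Definition insrow s := first_row (RS s).1.
Definition recrow s := first_row (RS s).2.

Lemma RS_rcons s x : RS (rcons s x) = RS_step (RS s) ((size s).+1, x).
Proof.
rewrite /RS size_rcons -(addn1 (size s)) iotaD /= cats1 zip_rcons ?size_iota //.
by rewrite -cats1 foldl_cat /= add1n addn1.
Qed.

Lemma row_insertE x t :
  first_row (row_insert x t).1 = row1 (first_row t) x /\
  ((row_insert x t).2 == 0) = ~~ has (fun y => x < y) (first_row t).
Proof.
case: t => [|r t] //=; rewrite /first_row /= /row1 has_find.
by case: ifP => // _; case: row_insert.
Qed.

Lemma insrow_rcons s x : insrow (rcons s x) = row1 (insrow s) x.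
Proof.
rewrite /insrow RS_rcons /RS_step /=; have := row_insertE x (RS s).1.
by case: row_insert => A h [-> _].
Qed.

Lemma recrow_rcons s x : recrow (rcons s x) =
  if has (fun y => x < y) (insrow s) then recrow s
  else rcons (recrow s) (size s).+1.
Proof.
rewrite /recrow RS_rcons /RS_step /=; have := row_insertE x (RS s).1.
case: row_insert => A h [_ /= e].
rewrite {1}/first_row nth_set_nth /= eq_sym e.
by case: (has _ _) e => //= /eqP ->.
Qed.

Lemma row1_cons z r x : row1 (z :: r) x = if x < z then x :: r else z :: row1 r x.
Proof. by rewrite /row1 /=; case: (x < z) => //=; rewrite ltnS; case: ifP. Qed.

Lemma row1_map f r x : {homo f : a b / a < b} ->
  row1 (map f r) (f x) = map f (row1 r x).
Proof.
move=> hf; have mf a b : (f a < f b) = (a < b).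
  case: (ltngtP a b) => [/hf//|/hf|->]; last by rewrite ltnn.
  by move=> h; apply/negbTE; rewrite -leqNgt ltnW.
elim: r => //= z r IH; rewrite !row1_cons mf IH.
by case: ifP.
Qed.

Lemma insrow_map f s : {homo f : a b / a < b} -> insrow (map f s) = map f (insrow s).
Proof.
move=> hf; elim/last_ind: s => // s x IH.
by rewrite map_rcons !insrow_rcons IH row1_map.
Qed.

Lemma recrow_map f s : {homo f : a b / a < b} -> recrow (map f s) = recrow s.
Proof.
move=> hf; have mf a b : (f a < f b) = (a < b).
  case: (ltngtP a b) => [/hf//|/hf|->]; last by rewrite ltnn.
  by move=> h; apply/negbTE; rewrite -leqNgt ltnW.
elim/last_ind: s => // s x IH.
rewrite map_rcons !recrow_rcons IH insrow_map // has_map size_map.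
by rewrite (eq_has (a2 := fun y => x < y)) // => y /=; rewrite mf.
Qed.

Lemma recrow_le s i : i \in recrow s -> 0 < i <= size s.
Proof.
elim/last_ind: s => // s x IH; rewrite recrow_rcons size_rcons.
case: ifP => _; first by move=> /IH; lia.
by rewrite mem_rcons inE => /orP [/eqP ->|/IH]; lia.
Qed.

Definition bumps (r : seq nat) x y :=
  (x < y) && all (fun z => (x < z) ==> (y <= z)) r.

Lemma mem_row1 r x y : sorted ltn r ->
  (y \in row1 r x) = (y == x) || (y \in r) && ~~ bumps r x y.
Proof.
elim: r => [|z r IH] sr; first by rewrite /row1 /= inE orbF.
have := sr; rewrite /= path_sortedE; last exact: ltn_trans.
move=> /andP [/allP zr /IH {}IH]; rewrite row1_cons /bumps /=.
case: (ltnP x z) => xz /=; rewrite !inE.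
  case: (y == x) => //=.
  case: (eqVneq y z) => [->|yz] /=.
    rewrite xz leqnn /=.
    have -> : all (fun t => (x < t) ==> (z <= t)) r.
      by apply/allP => t /zr zt; rewrite (ltnW zt) implybT.
    by apply/negbTE/negP => /zr; rewrite /= ltnn.
  case yr : (y \in r) => //=.
  by have := zr _ yr; rewrite /= => zy; rewrite [y <= z]leqNgt zy /= andbF.
rewrite IH /bumps; case: (eqVneq y z) => [->|yz] //=.
by rewrite [x < z]ltnNge xz orbT.
Qed.

Lemma row1_sorted r x : x \notin r -> sorted ltn r -> sorted ltn (row1 r x).
Proof.
elim: r => // z r IH xr sr; rewrite row1_cons.
have := sr; rewrite /= path_sortedE; last exact: ltn_trans.
move: xr; rewrite inE negb_or => /andP [xz xr] /andP [/allP zr sr'].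
case: (ltnP x z) => lt /=; (rewrite path_sortedE; last exact: ltn_trans).
  by rewrite sr' andbT; apply/allP => y /zr /=; apply: ltn_trans.
rewrite IH // andbT; apply/allP => y; rewrite mem_row1 //.
by case/orP=> [/eqP ->|/andP [/zr]//]; rewrite /=; lia.
Qed.

Lemma insrowP (s : seq nat) : uniq s -> sorted ltn (insrow s) /\ {subset insrow s <= s}.
Proof.
elim/last_ind: s => // s x IH; rewrite rcons_uniq => /andP [xs /IH [ss sub]].
have xr : x \notin insrow s by apply: contra xs; apply: sub.
rewrite insrow_rcons; split; first exact: row1_sorted.
move=> y; rewrite mem_row1 // mem_rcons inE => /orP [->//|/andP [/sub -> _]].
by rewrite orbT.
Qed.

Lemma mem_insrow_rcons (s : seq nat) x y : uniq s -> (y \in insrow (rcons s x))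
  = (y == x) || (y \in insrow s) && ~~ bumps (insrow s) x y.
Proof. by move=> /insrowP [ss _]; rewrite insrow_rcons mem_row1. Qed.

(** * Patterns and bumped entries *)

Definition before (s : seq nat) x y :=
  exists i j, [/\ i < j, j < size s, nth 0 s i = x & nth 0 s j = y].

Definition avoids3 (s : seq nat) := forall x y z,
  uniq s -> before s x y -> before s y z -> y < x -> z < y -> False.

Lemma before_rcons s c x y : before s x y -> before (rcons s c) x y.
Proof.
move=> [i [j [ij js ex ey]]]; exists i, j.
by rewrite size_rcons !nth_rcons js (ltn_trans ij js); split=> //; apply: ltnW.
Qed.

Lemma before_last s c x : x \in s -> before (rcons s c) x c.
Proof.
move=> xs; exists (index x s), (size s).
by rewrite size_rcons !nth_rcons index_mem xs nth_index // ltnn eqxx.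
Qed.

Lemma mem_before s x y : before s x y -> x \in s /\ y \in s.
Proof.
move=> [i [j [ij js <- <-]]]; split; apply: mem_nth => //.
exact: ltn_trans js.
Qed.

Lemma before_rcons_inv (s : seq nat) c x y : uniq (rcons s c) -> before (rcons s c) x y ->
  before s x y \/ x \in s /\ y = c.
Proof.
move=> us [i [j [ij]]]; rewrite size_rcons ltnS !nth_rcons => js ex ey.
have si : i < size s by lia.
move: ex ey; rewrite si; case: (ltnP j (size s)) => sj ex ey.
  by left; exists i, j.
right; split; first by rewrite -ex mem_nth.
by move: ey; have -> : j == size s by lia.
Qed.

(** The witness is the entry that bumped [y]. *)
Lemma bumped_before (s : seq nat) y : uniq s -> y \in s -> y \notin insrow s ->
  exists2 z, before s y z & z < y.
Proof.
elim/last_ind: s => // s c IH; rewrite rcons_uniq => /andP [cs us].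
rewrite mem_rcons inE mem_insrow_rcons // negb_or negb_and negbK.
move=> /orP [/eqP -> /andP [/eqP]//|ys /andP [_ /orP [yr|/andP [cy _]]]].
  by have [z byz zy] := IH us ys yr; exists z => //; apply: before_rcons.
by exists c => //; apply: before_last.
Qed.

(** If [z] was bumped although [y < z] stays in the first row, then something
    between [p] and [z] came after [z]: either what bumped [z], or [y]. *)
Lemma bumped_above (s : seq nat) p y z : uniq s -> p \notin s -> y \in insrow s ->
  z \in s -> z \notin insrow s -> p < y -> y < z ->
  exists q, [/\ before s z q, p < q & q < z].
Proof.
elim/last_ind: s => // s c IH; rewrite rcons_uniq mem_rcons inE negb_or.
move=> /andP [cs us] /andP [pc ps]; rewrite !mem_insrow_rcons // mem_rcons inE.
rewrite negb_or negb_and negbK => yr zs /andP [zc zr] py yz.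
have {}zs : z \in s by move: zs; rewrite (negbTE zc).
case/orP: yr => [/eqP yc|/andP [yr ny]].
  by exists c; rewrite -yc; split=> //; apply: before_last.
case zr' : (z \in insrow s) zr => /= zr; last first.
  have [q [b1 b2 b3]] := IH us ps yr zs (negbT zr') py yz.
  by exists q; split=> //; apply: before_rcons.
exists c; case/andP: zr => cz /allP mz; split=> //; first exact: before_last.
have := mz _ yr; have /insrowP [_ sub] := us.
have : y != c by apply: contraNneq cs => <-; apply: sub.
by case: (ltnP c y) => /=; lia.
Qed.

(** When [v] arrives, either [u] has already been bumped, or the first row has
    entries above [v] and [v] bumps the least of them. *)
Lemma inversion_bumps (s : seq nat) u v : uniq s -> before s u v -> v < u ->
  exists y, [/\ before s y v, v < y & y \notin insrow s].
Proof.
elim/last_ind: s => [|s c IH]; first by move=> _ [i [j []]].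
move=> us buv vu; have := us; rewrite rcons_uniq => /andP [cs us'].
case: (before_rcons_inv us buv) => [{}buv|[us_ ev]].
  have [y [b1 vy yr]] := IH us' buv vu; exists y; split=> //.
    exact: before_rcons.
  rewrite mem_insrow_rcons // (negbTE yr) orbF.
  by apply: contraNneq cs => <-; have [] := mem_before b1.
subst v; have [sr sub] := insrowP us'.
case hb : (has (fun y => c < y) (insrow s)).
  have ex : exists y, (y \in insrow s) && (c < y).
    by have /hasP [y yr cy] := hb; exists y; rewrite yr.
  case: (ex_minnP ex) => y /andP [yr cy] miny.
  exists y; split=> //; first by apply: before_last; apply: sub.
  rewrite mem_insrow_rcons // yr negb_or negbK /= neq_ltn cy orbT /=.
  rewrite /bumps cy; apply/allP => z zr; apply/implyP => cz.
  by apply: miny; rewrite zr.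
exists u; split=> //.
rewrite mem_insrow_rcons // negb_or negb_and (gtn_eqF vu) /=.
suff -> : u \notin insrow s by [].
by apply/negP => ur; move/hasPn: (negbT hb) => /(_ _ ur); rewrite vu.
Qed.

(** * Removing the last entry of a permutation *)

Lemma nth_one_line n (w : 'S_n) (i : 'I_n) : nth 0 (one_line w) i = (w i).+1.
Proof. by rewrite (nth_map i) ?size_enum_ord // nth_ord_enum. Qed.

Lemma size_one_line n (w : 'S_n) : size (one_line w) = n.
Proof. by rewrite size_map size_enum_ord. Qed.

Lemma one_line_uniq n (w : 'S_n) : uniq (one_line w).
Proof.
rewrite map_inj_uniq ?enum_uniq // => i j [/val_inj]; exact: perm_inj.
Qed.

Lemma mem_one_line n (w : 'S_n) v : (v \in one_line w) = (0 < v <= n).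
Proof.
apply/mapP/idP => [[i _ ->]|]; first exact: ltn_ord.
case: v => // v lt_vn.
exists ((w^-1)%g (Ordinal (lt_vn : v < n))); first by rewrite mem_enum.
by rewrite permKV.
Qed.

Lemma one_line_lift n (p : 'I_n.+1) (w : 'S_n) :
  one_line (lift_perm ord_max p w) = rcons (map (bump p.+1) (one_line w)) p.+1.
Proof.
rewrite /one_line enum_ordSr map_rcons lift_perm_id -!map_comp; congr rcons.
apply: eq_map => i /=; rewrite bumpS; congr _.+1.
have -> : widen_ord (leqnSn n) i = lift ord_max i by apply: ord_inj; rewrite lift_max.
by rewrite lift_perm_lift.
Qed.

Lemma lift_perm_ex n (v : 'S_n.+1) : exists w, v = lift_perm ord_max (v ord_max) w.
Proof.
have ex i : exists k, v (lift ord_max i) = lift (v ord_max) k.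
  case: (unliftP (v ord_max) (v (lift ord_max i))) => [k ->|]; first by exists k.
  by move/perm_inj/eqP; rewrite eq_sym (negbTE (neq_lift _ _)).
have [g gE] := fin_all_exists ex.
have g_inj : injective g.
  by move=> i j e; apply/(@lift_inj _ ord_max)/(@perm_inj _ v); rewrite !gE e.
exists (perm g_inj); apply/permP => i.
case: (unliftP ord_max i) => [k ->|->]; last by rewrite lift_perm_id.
by rewrite lift_perm_lift gE permE.
Qed.

Lemma avoids321_avoids3 n (w : 'S_n) : avoids321 w <-> avoids3 (one_line w).
Proof.
split=> [av x y z us [i [j [ij jn ex ey]]] [j' [k [jk kn ey' ez]]] yx zy|av i j k ij jk [h1 h2]].
  have ejj : j = j'.
    apply/eqP; rewrite -(nth_uniq 0 jn _ us) ?ey ?ey' //; exact: ltn_trans kn.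
  subst j'; rewrite size_one_line in jn kn.
  have iN : i < n by lia.
  apply: (av (Ordinal iN) (Ordinal jn) (Ordinal kn)) => //.
  have := nth_one_line w (Ordinal iN); have := nth_one_line w (Ordinal jn).
  by have := nth_one_line w (Ordinal kn); rewrite /= ex ey ez; lia.
have b (i1 i2 : 'I_n) : i1 < i2 -> before (one_line w) (w i1).+1 (w i2).+1.
  by move=> lt; exists i1, i2; rewrite !nth_one_line size_one_line ltn_ord.
by apply: av (one_line_uniq w) (b _ _ ij) (b _ _ jk) _ _.
Qed.

Lemma avoids321_lift n p (w : 'S_n) :
  avoids321 (lift_perm ord_max p w) -> avoids321 w.
Proof.
move=> av i j k ij jk [h1 h2].
apply: (av (lift ord_max i) (lift ord_max j) (lift ord_max k)).
- by rewrite !lift_max.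
- by rewrite !lift_max.
by rewrite !lift_perm_lift /= !ltnNge !leq_bump2 -!ltnNge.
Qed.

Lemma map_nseqE (T : eqType) T' (g : T -> T') c l :
  {in l, forall x, g x = c} -> map g l = nseq (size l) c.
Proof.
elim: l => //= x l IH h; rewrite h ?mem_head // IH // => y yl.
by apply: h; rewrite inE yl orbT.
Qed.

Definition upper_half n (w : 'S_n) :=
  [seq if i \in insrow (one_line w) then U else R | i <- iota 1 n].

Definition lower_half n (w : 'S_n) :=
  rev [seq if i \in recrow (one_line w) then R else U | i <- iota 1 n].

Lemma RSKhatE n (w : 'S_n) : RSKhat w = upper_half w ++ lower_half w.
Proof.
by rewrite /RSKhat /upper_half /lower_half /insrow /recrow; case: RS.
Qed.

Lemma size_upper_half n (w : 'S_n) : size (upper_half w) = n.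
Proof. by rewrite size_map size_iota. Qed.

Lemma nth_RSKhat n (w : 'S_n) j : 0 < j <= n ->
  nth U (RSKhat w) j.-1 = (j \in insrow (one_line w)).
Proof.
move=> jn; rewrite RSKhatE nth_cat size_upper_half.
have -> : j.-1 < n by lia.
rewrite (nth_map 0) ?size_iota ?nth_iota; try lia.
have -> : 1 + j.-1 = j by lia.
by case: (j \in _).
Qed.

Lemma mem_insrow_tail n (w : 'S_n) F a b X j : size F + a + b = n ->
  RSKhat w = F ++ nseq a R ++ nseq b U ++ X -> size F < j <= n ->
  (j \in insrow (one_line w)) = (size F + a < j).
Proof.
move=> sz e jn; rewrite -nth_RSKhat ?e; last lia.
rewrite nth_cat nth_cat nth_cat !size_nseq !nth_nseq.
have -> : j.-1 < size F = false by lia.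
case: (ltnP (j.-1 - size F) a) => h; first by rewrite /R; lia.
have -> : j.-1 - size F - a < b by lia.
by rewrite /U; lia.
Qed.

(** Appending the value [p + 1] bumps the first letter [U] that follows the
    first [p] letters, or nothing if there is none; as the letters from there
    on are [R^a U^b], both cases amount to inserting a peak. *)
Lemma RSKhat_lift n (w : 'S_n) F a b S2 : size F + a + b = n ->
  RSKhat w = F ++ nseq a R ++ nseq b U ++ S2 ->
  RSKhat (lift_perm ord_max (inord (size F)) w)
    = F ++ U :: R :: nseq a R ++ nseq b U ++ S2.
Proof.
move=> sz eRSK; move: (eRSK); set p := size F; rewrite !RSKhatE !catA => /eqP.
rewrite eqseq_cat; last by rewrite size_upper_half !size_cat !size_nseq.
case/andP=> /eqP eH /eqP eS.
have pn : (inord p : 'I_n.+1) = p :> nat by rewrite inordK //; lia.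
rewrite /upper_half /lower_half one_line_lift pn.
set s := one_line w in eH eS *; set f := bump p.+1.
have us : uniq s by exact: one_line_uniq.
have hf : {homo f : x y / x < y} by move=> x y; rewrite /f /bump; lia.
have fi : injective f by move=> x y; rewrite /f /bump; lia.
have ufs : uniq (map f s) by rewrite map_inj_uniq.
have /insrowP [_ sub] := us.
set r := insrow s in eH sub.
have rn i : i \in r -> 0 < i <= n by move=> /sub; rewrite mem_one_line.
have memr i : (i \in insrow (rcons (map f s) p.+1))
    = (i == p.+1) || (i \in map f r) && ~~ bumps (map f r) p.+1 i.
  by rewrite mem_insrow_rcons // insrow_map.
have split_iota : iota 1 n = iota 1 p ++ iota p.+1 (a + b).
  by rewrite -iotaD; congr iota; lia.
move: eH; rewrite /upper_half -/s -/r split_iota map_cat -catA => /eqP.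
rewrite eqseq_cat; last by rewrite size_map size_iota.
case/andP=> /eqP eF /eqP eab.
have rj j : p < j <= n -> (j \in r) = (p + a < j) by exact: mem_insrow_tail sz eRSK.
have hasr : has (fun y => p.+1 < y) (insrow (map f s)) = (0 < b).
  rewrite insrow_map // has_map -/r; apply/hasP/idP => [[y yr /=]|b0].
    have := rn _ yr; have := rj y; rewrite yr /f /bump; lia.
  by exists n; [rewrite rj; lia|rewrite /= /f /bump; lia].
have low i : i <= p -> (i \in insrow (rcons (map f s) p.+1)) = (i \in r).
  move=> ip; rewrite memr; have -> : i == p.+1 = false by lia.
  have ei : i = f i by rewrite /f /bump; lia.
  have -> : (i \in map f r) = (i \in r) by rewrite {1}ei; exact: mem_map.
  have -> : bumps (map f r) p.+1 i = false by rewrite /bumps; have -> : p.+1 < i = false by lia.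
  by rewrite andbT.
have high j : p < j <= n ->
    (j.+1 \in insrow (rcons (map f s) p.+1)) = ((p + a).+1 < j).
  move=> pj; rewrite memr; have -> : j.+1 == p.+1 = false by lia.
  have ej : j.+1 = f j by rewrite /f /bump; lia.
  rewrite /= ej mem_map // rj // -ej /bumps ltnS.
  case: (ltngtP j (p + a).+1) => [lt|gt|->].
  - by [].
  - have -> /= : p < j by lia.
    apply/allPn; exists (f (p + a).+1); first by rewrite mem_map // rj; lia.
    by rewrite /f /bump; lia.
  - rewrite ltnS leq_addr /=; apply/negbTE; rewrite negbK.
    apply/allP => _ /mapP [z zr ->]; apply/implyP.
    by have := rn _ zr; have := rj z; rewrite zr /f /bump; lia.
(* The values up to [p], the new value, and the values that it shifts. *)
have -> : iota 1 n.+1 = iota 1 p ++ p.+1 :: map succn (iota p.+1 (a + b)).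
  rewrite -(iotaDl 1) -[p.+1 :: _]/(iota p.+1 (a + b).+1) -iotaD.
  by congr iota; lia.
have eF' : [seq if i \in insrow (rcons (map f s) p.+1) then U else R | i <- iota 1 p] = F.
  by rewrite -[RHS]eF; apply/eq_in_map => i; rewrite mem_iota => ?; rewrite low //; lia.
have {eab} eX : [seq if i \in insrow (rcons (map f s) p.+1) then U else R
    | i <- map succn (iota p.+1 (a + b))] = [seq (p + a).+1 < j | j <- iota p.+1 (a + b)].
  rewrite -map_comp; apply/eq_in_map => j; rewrite mem_iota => ? /=.
  by rewrite high; [case: ltnP|lia].
rewrite map_cat eF' /= memr eqxx /= eX -!catA /=; congr (_ ++ _ :: _).
have -> : (p.+1 :: map succn (iota p.+1 (a + b))) = iota p.+1 (a + b).+1.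
  by rewrite /= -(iotaDl 1).
have -> : iota 1 p ++ iota p.+1 (a + b).+1 = rcons (iota 1 n) n.+1.
  by rewrite -iotaD -cats1 -[[:: n.+1]]/(iota n.+1 1) -iotaD; congr iota; lia.
rewrite map_rcons rev_rcons recrow_rcons hasr size_map size_one_line recrow_map //.
have -> : rev [seq if i \in (if 0 < b then recrow s else rcons (recrow s) n.+1)
    then R else U | i <- iota 1 n] = S2.
  rewrite -[RHS]eS; congr rev; apply/eq_in_map => i; rewrite mem_iota => ?.
  case: (0 < b) => //; rewrite mem_rcons inE.
  by have -> : i == n.+1 = false by lia.
have -> : (if n.+1 \in (if 0 < b then recrow s else rcons (recrow s) n.+1)
    then R else U) = ((p + a).+1 < (p.+1 + (a + b))).
  case: b {sz eS hasr split_iota eX eRSK rj} => [|b] /=.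
    by rewrite mem_rcons mem_head /R; lia.
  have -> : n.+1 \in recrow s = false.
    by apply/negbTE/negP => /recrow_le; rewrite size_one_line ltnn.
  by rewrite /U; lia.
rewrite -cat_rcons -map_rcons -cats1 -[[:: _ + _]]/(iota (p.+1 + (a + b)) 1).
rewrite -iotaD -addnA (addnC b) addnA iotaD map_cat.
rewrite (@map_nseqE _ _ _ R (iota p.+1 (a + 1))); last first.
  by move=> j; rewrite mem_iota /R => h; apply/negbTE; lia.
rewrite (@map_nseqE _ _ _ U); last by move=> j; rewrite mem_iota /U => h; lia.
by rewrite !size_iota addn1 -catA.
Qed.

Lemma before_map (f : nat -> nat) s x y : before (map f s) x y ->
  exists u v, [/\ before s u v, x = f u & y = f v].
Proof.
move=> [i [j [ij]]]; rewrite size_map => js.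
rewrite !(nth_map 0) ?(ltn_trans ij) // => <- <-.
by exists (nth 0 s i), (nth 0 s j); split=> //; exists i, j.
Qed.

Lemma bump_homo h : {homo bump h : x y / x < y}.
Proof. by move=> x y; rewrite /bump; lia. Qed.

Lemma code_RSKhat n P (w : 'S_n) : code P w -> avoids321 w /\ RSKhat w = P.
Proof.
elim: n P w => [|n IH] P w.
  by move=> /= ->; split=> [[]//|]; rewrite RSKhatE.
move=> [F [a [b [X [v [sz /IH [av eP] -> ->]]]]]].
split; last exact: RSKhat_lift.
have pn : (inord (size F) : 'I_n.+1) = size F :> nat by rewrite inordK //; lia.
apply/avoids321_avoids3; rewrite one_line_lift pn => x y z us bxy byz yx zy.
move/avoids321_avoids3 in av; move: us bxy byz.
set s := one_line v in av *; set p := size F in pn sz *; set f := bump p.+1 => us.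
have us0 : uniq s by exact: one_line_uniq.
have hf : {homo f : x y / x < y} by exact: bump_homo.
have pfs : p.+1 \notin map f s.
  by apply/negP => /mapP [i _]; rewrite /f /bump; lia.
have mf i j : f i < f j -> i < j by rewrite /f /bump; lia.
have inf i j : f i = f j -> i = j by rewrite /f /bump; lia.
move=> /(before_rcons_inv us) bxy /(before_rcons_inv us) byz.
have [yfs yz] : y \in map f s /\ (before (map f s) y z \/ z = p.+1).
  by case: byz => [b1|[]]; split=> //; [have [] := mem_before b1|left|right].
have {bxy} [u [t [but ex ey]]] : exists u t, [/\ before s u t, x = f u & y = f t].
  case: bxy => [/before_map//|[_ e]]; by rewrite e (negbTE pfs) in yfs.
subst x y; case: yz => [/before_map [t' [z' [btz /inf et ez]]]|ez].
  subst t'.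
  by rewrite ez in zy; apply: (av u t z'); rewrite ?us0 //; apply: mf.
have tu := mf _ _ yx.
have [t2 [b2 tt2 t2r]] := inversion_bumps us0 but tu.
have [ts us_] := mem_before but; have [t2s _] := mem_before b2.
have sn i : i \in s -> 0 < i <= n by rewrite mem_one_line.
have pt : p < t by move: zy; rewrite ez /f /bump; lia.
have tr : t \notin insrow s.
  move: t2r; rewrite !(mem_insrow_tail sz eP) -/p; first lia.
  - by have := sn _ us_; lia.
  - by have := sn _ t2s; lia.
have [z' b3 z't] := bumped_before us0 us_ tr.
exact: av us0 b2 b3 tt2 z't.
Qed.

Lemma no_descent (l : seq step) :
  (forall i j, i < j -> j < size l -> nth U l i = U -> nth U l j = U) ->
  exists a b, l = nseq a R ++ nseq b U.
Proof.
elim: l => [|x l IH] h; first by exists 0, 0.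
case: x h => h; last first.
  have [a [b ->]] : exists a b, l = nseq a R ++ nseq b U.
    by apply: IH => i j ij jl; exact: (h i.+1 j.+1).
  by exists a.+1, b.
exists 0, (size l).+1; congr cons.
apply/all_pred1P/allP => y /(nthP U) [j jl <-] /=.
by apply/eqP; apply: (h 0 j.+1).
Qed.

(** A letter [U] followed by a letter [R] after the first [p] letters would
    give, with a last entry [p + 1], a decreasing pattern. *)
Lemma avoids_code n (w : 'S_n) : avoids321 w -> code (RSKhat w) w.
Proof.
elim: n w => [|n IH] w avw; first by rewrite RSKhatE.
have [v ew] := lift_perm_ex w; move: avw; rewrite ew.
set q := w ord_max => avw.
have cv := IH _ (avoids321_lift avw).
set p : nat := q; have pn : p <= n by rewrite -ltnS ltn_ord.
move/avoids321_avoids3: avw; rewrite one_line_lift -/p.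
set s := one_line v; set f := bump p.+1 => av.
have us0 : uniq s by exact: one_line_uniq.
have hf : {homo f : x y / x < y} by exact: bump_homo.
have inf : injective f by move=> i j; rewrite /f /bump; lia.
have pfs : p.+1 \notin map f s.
  by apply/negP => /mapP [i _]; rewrite /f /bump; lia.
have us : uniq (map f s) by rewrite map_inj_uniq.
have usr : uniq (rcons (map f s) p.+1) by rewrite rcons_uniq pfs.
have szl : size (drop p (upper_half v)) = n - p.
  by rewrite size_drop size_upper_half.
have [a [b el]] : exists a b, drop p (upper_half v) = nseq a R ++ nseq b U.
  apply: no_descent => i j ij; rewrite szl => jl.
  have nthE k : k < n - p ->
      nth U (drop p (upper_half v)) k = ((p + k).+1 \in insrow s).
    move=> kn; rewrite nth_drop -nth_RSKhat; last lia.
    by rewrite RSKhatE nth_cat size_upper_half /=; have -> : p + k < n by lia.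
  rewrite !nthE; [|lia|lia] => yr.
  case zr : (_ \in insrow s) => //; exfalso.
  have zs : (p + j).+1 \in s by rewrite mem_one_line; lia.
  have [] := @bumped_above (map f s) p.+1 (f (p + i).+1) (f (p + j).+1).
  - exact: us.
  - exact: pfs.
  - by rewrite insrow_map // mem_map.
  - by rewrite mem_map.
  - by rewrite insrow_map // mem_map // zr.
  - by rewrite /f /bump; lia.
  - by rewrite /f /bump; lia.
  move=> z [bz pz zj].
  apply: (av _ _ _ usr (before_rcons _ bz) (before_last _ _) zj pz).
  by have [] := mem_before bz.
have sz : size (take p (upper_half v)) = p.
  by rewrite size_takel // size_upper_half.
have eR : RSKhat v = take p (upper_half v) ++ nseq a R ++ nseq b U ++ lower_half v.
  by rewrite RSKhatE -{1}(cat_take_drop p (upper_half v)) el -!catA.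
have szab : size (take p (upper_half v)) + a + b = n.
  by have := congr1 size el; rewrite szl sz size_cat !size_nseq; lia.
have eq : inord (size (take p (upper_half v))) = q.
  by apply: ord_inj; rewrite inordK sz.
exists (take p (upper_half v)), a, b, (lower_half v), v; split=> //.
- by rewrite -eR.
- by rewrite -eq (RSKhat_lift szab eR).
- by rewrite eq.
Qed.

Lemma RSKhat_unique n P : dyck_path n P ->
  exists2 w : 'S_n, code P w & unique (fun v : 'S_n => avoids321 v /\ RSKhat v = P) w.
Proof.
move=> /code_exists [w cw]; exists w => //; split; first exact: code_RSKhat.
by move=> v [/avoids_code cv eP]; apply: code_inj cw _; rewrite -eP.
Qed.

(** * Layers and their transpositions *)

Definition swap (i j p : nat) := if p == i then j else if p == j then i else p.

Definition act (L : seq (nat * nat)) (p : nat) :=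
  foldl (fun x ij => swap ij.1 ij.2 x) p L.

Lemma act_cat L1 L2 p : act (L1 ++ L2) p = act L2 (act L1 p).
Proof. exact: foldl_cat. Qed.

Definition pairs (l : seq nat) := zip l (behead l).

(** A layer is given by its separators, the steps [R] and then the steps [U]
    that no tile of the layer contains; its tiles lie between consecutive
    separators, and give the transpositions of these. The lowest tile of the
    layer, between the last [R] and the first [U], is at the bottom; the others
    follow, going away from it. *)
Definition layer := (seq nat * seq nat)%type.
Definition seps (l : layer) := l.1 ++ l.2.
Definition moves (l : layer) :=
  (last 0 l.1, head 0 l.2) :: pairs l.2 ++ rev (pairs l.1).

Record layer_ok n s k (l : layer) : Prop := LayerOk {
  layer_R0 : l.1 != [::];
  layer_U0 : l.2 != [::];
  layer_R : forall p, p \in l.1 -> p < size s /\ nth U s p = R;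
  layer_U : forall p, p \in l.2 -> p < size s /\ nth U s p = U;
  layer_sorted : sorted (fun p q => dint s p.+1 q) (seps l);
  layer_first : nR s (head 0 l.1) = k;
  layer_last : nU s (last 0 l.2) + k.+1 = n
}.

Lemma layer_lt n s k l : layer_ok n s k l -> sorted ltn (seps l).
Proof. by case=> _ _ _ _ + _ _; apply: sub_sorted => p q /and3P []. Qed.

Lemma layer_size n s k l p : layer_ok n s k l -> p \in seps l -> p < size s.
Proof.
by case=> _ _ hR hU _ _ _; rewrite mem_cat => /orP [/hR|/hU] [].
Qed.

Lemma layer_head_in n s k l : layer_ok n s k l -> head 0 l.1 \in l.1.
Proof. by case; case: l => -[//|x r] u *; rewrite mem_head. Qed.

Lemma layer_last_in n s k l : layer_ok n s k l -> last 0 l.2 \in l.2.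
Proof. by case; case: l => r [//|x u] *; rewrite /= mem_last. Qed.

Lemma layer_head_le n s k l p : layer_ok n s k l -> p \in seps l -> head 0 l.1 <= p.
Proof.
move=> lo; have := layer_lt lo; case: lo; case: l => -[//|x r] u _ _ _ _ _ _ _.
rewrite /seps /= path_sortedE; last exact: ltn_trans.
by move=> /andP [/allP h _]; rewrite inE => /orP [/eqP ->//|/h /ltnW].
Qed.

Lemma layer_last_ge n s k l p : layer_ok n s k l -> p \in seps l -> p <= last 0 l.2.
Proof.
move=> lo; have := layer_lt lo; case: lo; case: l => r u _ + _ _ _ _ _.
case/lastP: u => [//|u x _]; rewrite /seps /= last_rcons -rcons_cat => so.
have : sorted gtn (rev (rcons (r ++ u) x)) by rewrite rev_sorted.
rewrite rev_rcons /= path_sortedE; last by move=> a b c /=; lia.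
move=> /andP [/allP h _]; rewrite mem_rcons inE => /orP [/eqP ->//|pin].
by have := h p; rewrite mem_rev => /(_ pin) /=; lia.
Qed.

Lemma mem_pairs l i j : (i, j) \in pairs l -> i \in l /\ j \in l.
Proof.
elim: l => // x [//|y r] IH.
rewrite -[pairs _]/((x, y) :: pairs (y :: r)) inE => /orP [/eqP [-> ->]|/IH [hi hj]].
  by rewrite !inE !eqxx orbT.
by rewrite inE hi inE hj !orbT.
Qed.

Lemma mem_moves n s k l ij : layer_ok n s k l -> ij \in moves l ->
  ij.1 \in seps l /\ ij.2 \in seps l.
Proof.
move=> lo; case: ij => i j; rewrite inE mem_cat mem_rev /seps !mem_cat.
case/or3P=> [/eqP [-> ->]|/mem_pairs [-> ->]|/mem_pairs [-> ->]]; rewrite ?orbT //.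
case: lo; case: l => -[//|x r] -[//|y u] _ _ _ _ _ _ _.
by rewrite /= mem_last mem_head orbT.
Qed.

Lemma pairs_map (f : nat -> nat) l :
  pairs (map f l) = [seq (f ij.1, f ij.2) | ij <- pairs l].
Proof.
by rewrite /pairs; case: l => //= x l; elim: l x => //= y l IH x; rewrite IH.
Qed.

Lemma moves_map (f : nat -> nat) (l : layer) : l.1 != [::] -> l.2 != [::] ->
  moves (map f l.1, map f l.2) = [seq (f ij.1, f ij.2) | ij <- moves l].
Proof.
rewrite /moves /= map_cat map_rev !pairs_map.
by case: l => -[//|x r] [//|y u] _ _ /=; rewrite last_map.
Qed.

Lemma moves_cons h (l : layer) : l.1 != [::] ->
  moves (h :: l.1, l.2) = moves l ++ [:: (h, head 0 l.1)].
Proof.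
case: l => -[//|x r] u _; rewrite /moves /= -catA; congr (_ :: _ ++ _).
by rewrite {1}/pairs /= rev_cons cats1.
Qed.

Lemma moves_chain y b : 0 < b ->
  moves ([:: y], iota y.+1 b) = [seq (i, i.+1) | i <- iota y b].
Proof.
case: b => // b _; rewrite /moves /= cats0; congr cons.
by rewrite /pairs /=; elim: b y.+1 => //= b IH x; rewrite IH.
Qed.

Definition all_moves (lay : nat -> layer) K :=
  flatten [seq moves (lay k) | k <- iota 0 K].

Lemma all_movesS lay K : all_moves lay K.+1 = all_moves lay K ++ moves (lay K).
Proof.
by rewrite /all_moves -addn1 iotaD map_cat flatten_cat /= cats0.
Qed.

(** * Moves after inserting a peak *)

Section MovePeak.

Variable p0 : nat.

(** The positions other than [p0] and [h], numbered in order. *)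
Definition skip_hole h p :=
  if p < p0 then p else if p.+1 < h then p.+1 else p.+2.

(** [p0] and [p0.+1] are the positions of the inserted peak: its [U] stays in
    place, its [R] has come to [h], and everything else moves as it did. *)
Definition moved_peak h (g g' : nat -> nat) :=
  [/\ g p0 = p0, g p0.+1 = h & forall p, g (skip2 p0 p) = skip_hole h (g' p)].

Lemma skip_hole_inj h : injective (skip_hole h).
Proof.
move=> p q; rewrite /skip_hole.
by case: (ltnP p p0); case: (ltnP q p0); case: (ltnP p.+1 h); case: (ltnP q.+1 h); lia.
Qed.

Lemma skip_hole_neq h p : p0 < h -> skip_hole h p != p0 /\ skip_hole h p != h.
Proof.
by rewrite /skip_hole; case: (ltnP p p0); case: (ltnP p.+1 h); split; apply/eqP; lia.
Qed.

Lemma act_skip_hole h L p : p0 < h ->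
  (forall ij, ij \in L -> skip2 p0 ij.1 = skip_hole h ij.1
                       /\ skip2 p0 ij.2 = skip_hole h ij.2) ->
  let L' := [seq (skip2 p0 ij.1, skip2 p0 ij.2) | ij <- L] in
  [/\ act L' (skip_hole h p) = skip_hole h (act L p), act L' p0 = p0 & act L' h = h].
Proof.
move=> ph; elim: L p => [|[i j] L IH] p hL //=.
have [/= -> ->] := hL _ (mem_head _ _).
have {}hL ij : ij \in L -> skip2 p0 ij.1 = skip_hole h ij.1
                       /\ skip2 p0 ij.2 = skip_hole h ij.2.
  by move=> ijL; apply: hL; rewrite inE ijL orbT.
have [h1 h2] := skip_hole_neq i ph; have [h3 h4] := skip_hole_neq j ph.
have -> : swap (skip_hole h i) (skip_hole h j) (skip_hole h p) = skip_hole h (swap i j p).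
  by rewrite /swap !(inj_eq (@skip_hole_inj h)); case: (p == i); case: (p == j).
have -> : swap (skip_hole h i) (skip_hole h j) p0 = p0.
  by rewrite /swap ![p0 == _]eq_sym (negbTE h1) (negbTE h3).
have -> : swap (skip_hole h i) (skip_hole h j) h = h.
  by rewrite /swap ![h == _]eq_sym (negbTE h2) (negbTE h4).
by have [e1 e2 e3] := IH (swap i j p) hL.
Qed.

Lemma moved_peak_skip h g g' L : p0 < h -> moved_peak h g g' ->
  (forall ij, ij \in L -> skip2 p0 ij.1 = skip_hole h ij.1
                       /\ skip2 p0 ij.2 = skip_hole h ij.2) ->
  moved_peak h (act [seq (skip2 p0 ij.1, skip2 p0 ij.2) | ij <- L] \o g)
    (act L \o g').
Proof.
move=> ph [e1 e2 e3] hL; split=> [||p] /=.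
- by rewrite e1; have [_ ->] := act_skip_hole 0 ph hL.
- by rewrite e2; have [_ _ ->] := act_skip_hole 0 ph hL.
- by rewrite e3; have [-> _ _] := act_skip_hole (g' p) ph hL.
Qed.

(** The tile that is a single box between the steps [h] and [h.+1]. *)
Lemma moved_peak_next h g g' : p0 < h -> moved_peak h g g' ->
  moved_peak h.+1 (swap h h.+1 \o g) g'.
Proof.
move=> ph [e1 e2 e3]; split=> [||p] /=.
- by rewrite e1 /swap; repeat case: eqP; lia.
- by rewrite e2 /swap eqxx.
- rewrite e3 /swap /skip_hole; case: (ltnP (g' p) p0) => h1.
    by repeat case: eqP; lia.
  by case: (ltnP (g' p).+1 h) => h2; case: (ltnP (g' p).+1 h.+1) => h3;
    repeat case: eqP; lia.
Qed.

Lemma moved_peak_chain h b g g' : p0 < h -> moved_peak h g g' ->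
  moved_peak (h + b) (act [seq (i, i.+1) | i <- iota h b] \o g) g'.
Proof.
elim: b h g => [|b IH] h g ph; first by rewrite addn0.
move=> /(moved_peak_next ph) /(IH _ _ (leqW ph)); rewrite addSnnS.
by case=> e1 e2 e3; split.
Qed.

End MovePeak.

(** * The layers of a path and its permutation *)

Lemma nR_run F a (X : seq step) j : j <= a ->
  nR (F ++ nseq a R ++ X) (size F + j) = count_mem R F + j.
Proof.
move=> ja; rewrite /= take_cat ltnNge leq_addr /= addKn take_cat size_nseq.
case: ltnP => [lt|ge]; first by rewrite take_nseq // count_cat count_nseq mul1n.
have -> : j = a by lia.
by rewrite subnn take0 cats0 count_cat count_nseq mul1n.
Qed.

Lemma nR_run2 F a b (X : seq step) j : j <= b ->
  nR (F ++ nseq a R ++ nseq b U ++ X) (size F + a + j) = count_mem R F + a.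
Proof.
move=> jb; rewrite catA.
have -> : size F + a + j = size (F ++ nseq a R) + j by rewrite size_cat size_nseq.
rewrite /= take_cat ltnNge leq_addr /= addKn take_cat size_nseq.
case: ltnP => [lt|ge].
  by rewrite take_nseq // !count_cat !count_nseq mul1n mul0n addn0.
have -> : j = b by lia.
by rewrite subnn take0 cats0 !count_cat !count_nseq mul1n mul0n addn0.
Qed.

Lemma nth_run F a (X : seq step) j : j < a -> nth U (F ++ nseq a R ++ X) (size F + j) = R.
Proof.
by move=> ja; rewrite nth_cat ltnNge leq_addr addKn nth_cat size_nseq ja nth_nseq ja.
Qed.

Lemma nR_inj s p q : p < size s -> q < size s -> nth U s p = R -> nth U s q = R ->
  nR s p = nR s q -> p = q.
Proof.
move=> ps qs ep eq e; have := nRS ps; have := nRS qs; rewrite ep eq eqxx e.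
by case: (ltngtP p q) => // lt; have := nR_le s lt; move: e => /=; lia.
Qed.

Section InsertPeakLayers.

Variables (n a b : nat) (F X : seq step).
Let p0 := size F.
Let Y := nseq a R ++ nseq b U ++ X.
Let P := F ++ U :: R :: Y.
Let P' := F ++ Y.
Hypothesis sz : p0 + a + b = n.
Hypothesis dP : dyck_path n P'.

Let szP' : size P' = n + n.
Proof. by case: dP => /lattice_path_size. Qed.

Let szP : size P = (n + n).+2.
Proof. by rewrite size_peak szP'. Qed.

Let c := count_mem R F.

Let nR_P' j : j <= a -> nR P' (p0 + j) = c + j.
Proof. exact: nR_run. Qed.

Let nR_P'n : nR P' n = c + a.
Proof. by rewrite -sz; apply: nR_run2. Qed.

Let eP : P = rcons F U ++ nseq a.+1 R ++ nseq b U ++ X.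
Proof. by rewrite /P cat_rcons. Qed.

Let count_rcons : count_mem R (rcons F U) = c.
Proof. by rewrite -cats1 count_cat /= !addn0. Qed.

Let nR_P j : j <= a.+1 -> nR P (p0.+1 + j) = c + j.
Proof.
move=> ja; rewrite eP; have := nR_run (rcons F U) (nseq b U ++ X) ja.
by rewrite size_rcons count_rcons.
Qed.

Let nR_Pn : nR P n.+1 = c + a + (0 < b).
Proof.
case: (posnP b) => b0.
  have -> : n.+1 = p0.+1 + a by lia.
  by rewrite nR_P; lia.
have := @nR_run2 (rcons F U) a.+1 b X b.-1 (leq_pred b); rewrite -eP.
rewrite size_rcons count_rcons.
have -> : p0.+1 + a.+1 + b.-1 = n.+1 by lia.
by move=> ->; lia.
Qed.

Let nth_P j : j <= a -> nth U P (p0.+1 + j) = R.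
Proof.
move=> ja; rewrite eP; have := @nth_run (rcons F U) a.+1 (nseq b U ++ X) j ja.
by rewrite size_rcons.
Qed.

Let nR_skip p : nR P (skip2 p0 p) = nR P' p + (p0 <= p).
Proof.
rewrite nR_peak -/p0 /skip2; case: (ltnP p p0) => h.
  by congr (nR _ _ + _); rewrite /unpeak; repeat case: ifP; lia.
by congr (nR _ _ + _); rewrite /unpeak; repeat case: ifP; lia.
Qed.

Let nU_skip p : nU P (skip2 p0 p) = nU P' p + (p0 <= p).
Proof.
rewrite nU_peak -/p0 /skip2; case: (ltnP p p0) => h.
  by congr (nU _ _ + _); rewrite /unpeak; repeat case: ifP; lia.
by congr (nU _ _ + _); rewrite /unpeak; repeat case: ifP; lia.
Qed.

Variable lay' : nat -> layer.
Hypothesis lay'_ok : forall k, k < nR P' n -> layer_ok n P' k (lay' k).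

(** The [R] of the peak precedes a run of steps [R], each of which is the first
    separator of a layer; it is a further separator of these layers. If steps
    [U] come next in the first half of the path, then the peak creates a step
    [R] in that half, hence a layer, which consists of single boxes. *)
Definition peak_layer k : layer :=
  let l := (map (skip2 p0) (lay' k).1, map (skip2 p0) (lay' k).2) in
  if k < c then l
  else if k < c + a then (p0.+1 + (k - c) :: l.1, l.2)
  else ([:: p0.+1 + a], iota (p0.+1 + a).+1 b).

Let head_lay' k : k < nR P' n ->
  if k < c then head 0 (lay' k).1 < p0 else head 0 (lay' k).1 == p0 + (k - c).
Proof.
move=> kK; have lo := lay'_ok kK; have hin := layer_head_in lo.
have [hs hR] := layer_R lo hin; have hk := layer_first lo.
move: kK; rewrite nR_P'n => kK; case: ltnP => kc.
  rewrite ltnNge; apply/negP => le; have := nR_le P' le; rewrite hk.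
  by have := @nR_P' 0 (leq0n _); rewrite addn0 => ->; lia.
apply/eqP; apply: nR_inj hs _ hR _ _; first by rewrite szP'; lia.
- by apply: nth_run; lia.
- by rewrite hk nR_P'; lia.
Qed.

Let last_lay' k : k < nR P' n -> n <= last 0 (lay' k).2.
Proof.
move=> kK; have lo := lay'_ok kK; have lin := layer_last_in lo.
have [ls lU] := layer_U lo lin; have lk := layer_last lo.
rewrite leqNgt; apply/negP => lt; have := nU_le P' lt.
rewrite nUS // lU eqxx; have := @nRUE P' n ltac:(lia); lia.
Qed.

Let skip_ok k : k < nR P' n ->
  let l := (map (skip2 p0) (lay' k).1, map (skip2 p0) (lay' k).2) in
  [/\ l.1 != [::], l.2 != [::],
      forall p, p \in l.1 -> p < size P /\ nth U P p = R,
      forall p, p \in l.2 -> p < size P /\ nth U P p = U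
    & sorted (fun p q => dint P p.+1 q) (seps l) /\ nU P (last 0 l.2) + k.+1 = n.+1].
Proof.
move=> kK; have lo := lay'_ok kK; have ln := last_lay' kK.
have lsz p : p < size P' -> skip2 p0 p < size P.
  by rewrite szP' szP /skip2; case: ifP; lia.
split=> /=.
- by case: lo; case: (lay' k) => -[].
- by case: lo; case: (lay' k) => r [].
- move=> _ /mapP [p /(layer_R lo) [ps eq] ->]; split; first exact: lsz.
  by rewrite nth_peak.
- move=> _ /mapP [p /(layer_U lo) [ps eq] ->]; split; first exact: lsz.
  by rewrite nth_peak.
split.
  rewrite /seps /= -map_cat sorted_map.
  refine (sub_in_sorted (P := [pred p | p < size P']) _ _ (layer_sorted lo)); last first.
    by apply/allP => p /(layer_size lo).
  move=> p q ps qs /= h; rewrite -dint_peak //.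
  by case/and3P: h.
have -> : last 0 (map (skip2 p0) (lay' k).2) = skip2 p0 (last 0 (lay' k).2).
  by case: lo; case: (lay' k) => r [//|x u] _ _ _ _ _ _ _; rewrite /= last_map.
by have := layer_last lo; have := nU_skip (last 0 (lay' k).2) => /=; lia.
Qed.

Lemma peak_layer_ok k : k < nR P n.+1 -> layer_ok n.+1 P k (peak_layer k).
Proof.
rewrite nR_Pn => kK; rewrite /peak_layer.
case: (ltnP k (c + a)) => kca; last first.
  have [b0 ek] : 0 < b /\ k = c + a by lia.
  have -> : k < c = false by lia.
  have szb i : i < b -> (p0.+1 + a).+1 + i < size P by rewrite szP; lia.
  have nthU i : i < b -> nth U P ((p0.+1 + a).+1 + i) = U.
    move=> ib; rewrite eP nth_cat size_rcons -/p0.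
    have -> : (p0.+1 + a).+1 + i < p0.+1 = false by lia.
    rewrite nth_cat size_nseq.
    have -> : (p0.+1 + a).+1 + i - p0.+1 < a.+1 = false by lia.
    rewrite nth_cat size_nseq nth_nseq.
    by have -> : (p0.+1 + a).+1 + i - p0.+1 - a.+1 < b by lia.
  split=> //.
  - by case: (b) b0.
  - by move=> p /=; rewrite inE => /eqP ->; rewrite szP nth_P //; split=> //; lia.
  - move=> p /=; rewrite mem_iota => hp.
    have -> : p = (p0.+1 + a).+1 + (p - (p0.+1 + a).+1) by lia.
    by split; [apply: szb|apply: nthU]; lia.
  - rewrite /seps /= {szb nthU}; elim: (b) (p0.+1 + a) => //= b' IH x.
    by rewrite IH andbT; apply: dint_refl.
  - by rewrite ek; exact: nR_P (leqnSn a).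
  - have -> : last 0 ([:: p0.+1 + a], iota (p0.+1 + a).+1 b).2 = n.+1.
      rewrite /= (last_nth 0) size_iota; case: (b) b0 sz => // b' _ ?.
      by rewrite -[nth _ _ _]/(nth 0 (iota (p0.+1 + a).+1 b'.+1) b') nth_iota //; lia.
    have := @nRUE P n.+1 ltac:(rewrite szP; lia); rewrite nR_Pn ek; lia.
have kK' : k < nR P' n by rewrite nR_P'n.
have [l1 l2 lR lU [lS lL]] := skip_ok kK'; have hd := head_lay' kK'.
have lo := lay'_ok kK'.
have eh : head 0 (map (skip2 p0) (lay' k).1) = skip2 p0 (head 0 (lay' k).1).
  by case: (lay' k) l1 => -[].
case: (ltnP k c) hd => kc hd.
  split=> //; have := nR_skip (head 0 (lay' k).1); rewrite (layer_first lo) -eh.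
  by have -> : p0 <= head 0 (lay' k).1 = false; [lia|rewrite addn0].
move/eqP: hd => hd; split=> //.
- move=> p /=; rewrite inE => /orP [/eqP ->|/lR//].
  by rewrite szP nth_P; [split; lia|lia].
- have e2 : skip2 p0 (head 0 (lay' k).1) = (p0.+1 + (k - c)).+1.
    by rewrite /skip2 hd ltnNge leq_addr.
  move: lS; rewrite /seps /=; case: (map _ (lay' k).1) l1 eh => //= x r _ ex.
  by rewrite ex e2 => ->; rewrite andbT; apply: dint_refl.
- have := @nR_P (k - c) ltac:(lia); by have -> : c + (k - c) = k by lia.
Qed.

Lemma peak_layer_moves k : k <= nR P' n ->
  moved_peak p0 (p0.+1 + (k - c)) (act (all_moves peak_layer k)) (act (all_moves lay' k)).
Proof.
elim: k => [_|k IH kK].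
  rewrite sub0n addn0; split=> // p; rewrite /= /skip2 /skip_hole ltnS.
  by case: ltnP.
have {IH} := IH (ltnW kK); set h := p0.+1 + _ => mp.
have ph : p0 < h by rewrite /h; lia.
have lo := lay'_ok kK; have [l1 l2 _ _ _] := skip_ok kK; have hd := head_lay' kK.
have hole i : i \in seps (lay' k) -> skip2 p0 i = skip_hole p0 h i.
  move=> /(layer_head_le lo); move: hd; rewrite /skip2 /skip_hole /h.
  by case: (ltnP k c) => kc hd; case: (ltnP i p0) => //; case: ltnP => //; lia.
have {mp} := moved_peak_skip ph mp (fun ij hij =>
  conj (hole _ (mem_moves lo hij).1) (hole _ (mem_moves lo hij).2)).
have [m1 m2] : (lay' k).1 != [::] /\ (lay' k).2 != [::] by case: lo.
have ext g1 g2 g1' g2' h1 h2 : g1 =1 g2 -> g1' =1 g2' -> h1 = h2 ->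
    moved_peak p0 h1 g1 g1' -> moved_peak p0 h2 g2 g2'.
  by move=> e e' <- [e1 e2 e3]; split=> [||p]; rewrite -?e -?e'.
rewrite !all_movesS /peak_layer.
move: kK hd; rewrite nR_P'n => kK; rewrite kK.
case: (ltnP k c) => kc hd.
  apply: ext => [p|p|]; rewrite ?act_cat ?moves_map //.
  by rewrite /h; lia.
move/eqP: hd => hd; move/(moved_peak_next ph); apply: ext => [p|p|].
- rewrite act_cat (@moves_cons _ (_, _)) // act_cat (@moves_map _ (lay' k)) //=.
  congr swap; rewrite (_ : head 0 _ = skip2 p0 (head 0 (lay' k).1)); last first.
    by case: (lay' k) m1 => -[].
  by rewrite /skip2 hd ltnNge leq_addr /= /h; lia.
- by rewrite act_cat.
- by rewrite /h; lia.
Qed.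

Lemma peak_moves :
  moved_peak p0 n.+1 (act (all_moves peak_layer (nR P n.+1)))
    (act (all_moves lay' (nR P' n))).
Proof.
have mp := peak_layer_moves (leqnn _); move: mp; rewrite nR_Pn nR_P'n.
have -> : c + a - c = a by lia.
case: (posnP b) => b0 mp.
  by rewrite addn0; have -> : n.+1 = p0.+1 + a by lia.
have {mp} := moved_peak_chain b (ltn_addr a (ltnSn p0)) mp.
have -> : p0.+1 + a + b = n.+1 by lia.
have epl : peak_layer (c + a) = ([:: p0.+1 + a], iota (p0.+1 + a).+1 b) :> layer.
  by rewrite /peak_layer ltnNge leq_addr ltnn.
rewrite addn1 all_movesS epl moves_chain //.
case=> e1 e2 e3; split=> [||p]; rewrite act_cat.
- exact: e1.
- exact: e2.
- exact: e3.
Qed.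

End InsertPeakLayers.

Lemma paren_matched_peak F X p q : let p0 := size F in
  q < size (F ++ U :: R :: X) -> paren_matched (F ++ U :: R :: X) p q ->
  p = p0 /\ q = p0.+1 \/
  exists p' q', [/\ p = skip2 p0 p', q = skip2 p0 q', q' < size (F ++ X)
                  & paren_matched (F ++ X) p' q'].
Proof.
move=> p0 qs /(paren_matchedP _ qs) [pq ep eq h].
have szP := size_peak F X.
have lv t := @lev_peak F X t; rewrite -/p0 in lv.
have lvp : lev (F ++ U :: R :: X) p0.+1 = (lev (F ++ U :: R :: X) p0).+1.
  by rewrite levU ?nth_peakU // size_cat -addSnnS leq_addr.
have lvq : lev (F ++ U :: R :: X) p0.+1 = (lev (F ++ U :: R :: X) p0.+2).+1.
  by rewrite -levR ?nth_peakR // size_cat /= -!addSnnS leq_addr.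
have /dintP [_ e1 e2] := h.
case: (eqVneq p p0) => [pe|np].
  left; split=> //; subst p.
  case: (ltngtP q p0.+1) => // [|gt]; first lia.
  by have := e2 p0.+2 ltac:(lia); lia.
case: (eqVneq q p0.+1) => [qe|nq].
  have plt : p < p0 by lia.
  by have := e2 p0 ltac:(lia); rewrite e1 qe lvp; lia.
have np1 : p != p0.+1 by apply: contraTneq isT => pe; move: ep; rewrite pe nth_peakR.
have nq0 : q != p0 by apply: contraTneq isT => qe; move: eq; rewrite qe nth_peakU.
have sk t : t != p0 -> t != p0.+1 -> exists t', t = skip2 p0 t'.
  move=> t1 t2; exists (if t < p0 then t else t.-2); rewrite /skip2.
  by case: (ltnP t p0) => h1; [rewrite h1|case: ltnP; lia].
have [p' ep'] := sk _ np np1; have [q' eq'] := sk _ nq0 nq.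
right; exists p', q'; subst p q.
have pq' : p' < q' by move: pq; rewrite /skip2; case: ifP; case: ifP; lia.
have szF : p0 <= size (F ++ X) by rewrite size_cat leq_addr.
have qs' : q' < size (F ++ X).
  by move: qs; rewrite szP /skip2; case: ifP; lia.
split=> //; apply/paren_matchedP => //; split=> //.
- by move: ep; rewrite nth_peak.
- by move: eq; rewrite nth_peak.
- by rewrite dint_peak.
Qed.

(** By [peak_moves], the positions of the peak end up at [p] and in the middle
    of the path, where the last entry is read, and the other pairs behave as
    for the shorter path. *)
Lemma code_layers n P (w : 'S_n) : code P w -> exists lay : nat -> layer,
  (forall k, k < nR P n -> layer_ok n P k (lay k)) /\
  forall p q, q < size P -> paren_matched P p q ->
    exists v : 'I_n, act (all_moves lay (nR P n)) q = n + n - v.+1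
                  /\ act (all_moves lay (nR P n)) p = w v.
Proof.
elim: n P w => [|n IH] P w.
  by move=> /= ->; exists (fun=> ([::], [::])); split=> // k; rewrite /pos /=.
move=> [F [a [b [X [w' [sz cw -> ->]]]]]].
have dP := code_dyck_path cw; have [lay' [ok pm]] := IH _ _ cw.
exists (peak_layer a b F lay'); split=> [k|p q qs]; first exact: peak_layer_ok.
have [e1 e2 e3] := peak_moves sz dP ok.
have ep0 : (inord (size F) : 'I_n.+1) = size F :> nat by rewrite inordK //; lia.
case/(paren_matched_peak qs) => [[-> ->]|[p' [q' [-> -> qs' /(pm _ _ qs') [v [eq ep]]]]]].
  exists ord_max; rewrite e1 e2 lift_perm_id ep0 /=; lia.
exists (lift ord_max v); rewrite !e3 eq ep lift_perm_lift lift_max /= ep0 /skip_hole /bump.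
have vn := ltn_ord v; have wn := ltn_ord (w' v).
have -> : n + n - v.+1 < size F = false by lia.
have -> : (n + n - v.+1).+1 < n.+1 = false by lia.
have -> : (w' v).+1 < n.+1 by lia.
by split; [lia|case: (ltnP (w' v) (size F)) => h; lia].
Qed.

(** * Boxes, layers and tiles *)

Notation antidiag b := ((b.1 + b.2).+1).

Lemma nR_reach s x t : x < nR s t -> exists i, [/\ i < t, i < size s, nth U s i = R & nR s i = x].
Proof.
elim: t => [|t IH]; first by rewrite /= take0.
case: (ltnP x (nR s t)) => [/IH [i [it is_ iR ix]] _|le lt].
  by exists i; split=> //; apply: ltnW.
have ts : t < size s.
  rewrite ltnNge; apply/negP => st; move: lt le; rewrite /= !take_oversize //; lia.
by exists t; move: lt; rewrite nRS //; case: eqP => [e|_] lt; split=> //; lia.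
Qed.

(** A path meets each antidiagonal once; a box is above the path when it lies
    north-west of that point. *)
Lemma in_above n s (b : box n) : lattice_path n s ->
  (b \in above n s) = (b.1 < nR s (antidiag b)).
Proof.
move=> ls; have szs := lattice_path_size ls.
have b1 := ltn_ord b.1; have b2 := ltn_ord b.2.
rewrite inE; apply/existsP/idP => [[i /and3P [/eqP iR /eqP ix le]]|lt].
  have is_ := ltn_ord i; have := nRS is_; rewrite iR eqxx ix => e.
  have it : i < antidiag b by have := nRUE (ltnW is_); rewrite ix; lia.
  by have := nR_le s it; rewrite e; lia.
have [i [it is_ iR ix]] := nR_reach lt.
exists (Ordinal is_); apply/and3P; split; [exact/eqP|exact/eqP|].
have ti : antidiag b <= size s by lia.
suff : nU s i <= b.2 by [].
have := nRUE ti; have := nRUE (ltnW is_); rewrite ix.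
have := nU_le s (ltnW it); lia.
Qed.

Lemma box_ex n x y : x < n -> y < n -> exists b : box n, b.1 = x :> nat /\ b.2 = y :> nat.
Proof. by move=> xn yn; exists (Ordinal xn, Ordinal yn). Qed.

Lemma box_inj n (b c : box n) : b.1 = c.1 :> nat -> b.2 = c.2 :> nat -> b = c.
Proof.
by case: b c => b1 b2 [c1 c2] /= e1 e2; congr pair; apply: ord_inj.
Qed.

Lemma cornerE n (b : box n) : corner b = (nat_of_ord b.1, nat_of_ord b.2).
Proof. by []. Qed.

Lemma corner_inj n : injective (@corner n).
Proof. by move=> b c [e1 e2]; apply: box_inj. Qed.

Lemma boxes_of_corners n (l : seq (nat * nat)) :
  (forall c, c \in l -> c.1 < n /\ c.2 < n) ->
  exists bs : seq (box n), [seq corner b | b <- bs] = l.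
Proof.
elim: l => [|[x y] l IH] h; first by exists [::].
have [|bs ebs] := IH; first by move=> c cl; apply: h; rewrite inE cl orbT.
have [/= xn yn] := h _ (mem_head _ _); have [b [b1 b2]] := box_ex xn yn.
by by exists (b :: bs); rewrite -ebs -b1 -b2.
Qed.

(** A tile is recorded by the number [k] of boxes that separate its boxes from
    the path in direction south-east, and by the steps [p] and [q] of the path
    that come before and after its antidiagonals. *)
Section Tiles.

Variables (n : nat) (P : seq step).

Definition cells k p q : {set box n} :=
  [set b : box n | (p < antidiag b <= q) && ((b.1 + k).+1 == nR P (antidiag b))].

(** On each antidiagonal between the steps, the box translated [k] times from
    the path is in the square. *)
Definition fits k p q :=
  [/\ p < q, q < n + n
    & forall t, p < t <= q -> k < nR P t /\ nU P t + k < n].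

Lemma in_cells k p q b : (b \in cells k p q) =
  (p < antidiag b <= q) && ((b.1 + k).+1 == nR P (antidiag b)).
Proof. by rewrite inE. Qed.

Lemma cells_at k p q t : lattice_path n P -> fits k p q -> p < t <= q ->
  exists b, [/\ b \in cells k p q, antidiag b = t & (b.1 + k).+1 = nR P t].
Proof.
move=> lP [_ qn h] ht; have [kR kU] := h _ ht.
have szP := lattice_path_size lP; have [_ cR] := lP; have := nR_le_all P t.
rewrite cR => nRn; have eRU := @nRUE P t ltac:(lia).
have [] := @box_ex n (nR P t - k.+1) (nU P t + k); first by lia.
  by lia.
move=> b [b1 b2]; exists b; rewrite in_cells b1 b2.
have -> : (nR P t - k.+1 + (nU P t + k)).+1 = t by lia.
by split=> //; [apply/andP; split=> //; apply/eqP|]; lia.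
Qed.

Lemma cells_n0 k p q : lattice_path n P -> fits k p q -> cells k p q != set0.
Proof.
move=> lP fe; have [pq _ _] := fe.
have [|b [be _ _]] := @cells_at k p q q lP fe; first by rewrite pq /=.
by apply/set0Pn; exists b.
Qed.

Lemma cells_dyck_tile k p q : lattice_path n P -> fits k p q ->
  dint P p.+1 q -> dyck_tile (cells k p q).
Proof.
move=> lP [pq qn h] di; have szP := lattice_path_size lP.
have [_ cR] := lP; have nRn := nR_le_all P; rewrite cR in nRn.
have qs : q <= size P by lia.
set D := drop p.+1 (take q P).
have szD : size D = q - p.+1 by rewrite size_drop size_takel.
have F j : j <= q - p.+1 -> nR P (p.+1 + j) = nR P p.+1 + nR D j /\
  nU P (p.+1 + j) = nU P p.+1 + nU D j by exact: pos_factor.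
have L j : j <= q - p.+1 -> nR P (p.+1 + j) + nU P (p.+1 + j) = p.+1 + j.
  by move=> jq; apply: nRUE; lia.
have H j : j <= q - p.+1 -> k < nR P (p.+1 + j) /\ nU P (p.+1 + j) + k < n.
  by move=> jq; apply: h; lia.
have [k0 _] := h p.+1 ltac:(lia).
pose x := nR P p.+1 - k.+1; pose y := nU P p.+1 + k.
have [|bs ebs] := @boxes_of_corners n
    [seq (x + (pos D j).1, y + (pos D j).2) | j <- iota 0 (size D).+1].
  move=> _ /mapP [j + ->]; rewrite mem_iota szD add0n ltnS => /andP [_ jq].
  suff [] : x + nR D j < n /\ y + nU D j < n by [].
  have [e1 e2] := F _ jq; have := H _ jq; have := L _ jq; have := nRn (p.+1 + j).
  by rewrite e1 e2 /x /y; lia.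
exists D, x, y, bs; split=> //; first exact/dyck_word_factor.
apply/setP => b; rewrite in_cells inE -(mem_map (@corner_inj n)) ebs.
apply/idP/mapP => [/andP [ht /eqP e1]|[j]].
  exists (antidiag b - p.+1); first by rewrite mem_iota szD; lia.
  have jq : antidiag b - p.+1 <= q - p.+1 by lia.
  have [] := F _ jq; have := L _ jq.
  have -> : p.+1 + (antidiag b - p.+1) = antidiag b by lia.
  by rewrite cornerE /x /y => e2 e3 e4; congr pair; lia.
rewrite mem_iota szD add0n ltnS cornerE => /andP [_ jq] ec.
have b1 : b.1 = x + nR D j :> nat := congr1 fst ec.
have b2 : b.2 = y + nU D j :> nat := congr1 snd ec.
have [e1 e2] := F _ jq; have := L _ jq; have [e3 _] := H _ jq.
move: b1 b2; rewrite /x /y => b1 b2 e4.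
have -> : (b.1 + b.2).+1 = p.+1 + j by rewrite b1 b2; lia.
by apply/andP; split; [|rewrite b1; apply/eqP]; lia.
Qed.

End Tiles.

(** * The tiling by maximal Dyck factors *)

Lemma pairs_sorted (r : rel nat) l i j : sorted r l -> (i, j) \in pairs l -> r i j.
Proof.
elim: l => // x [//|y l] IH /= /andP [rxy srt].
rewrite -[pairs _]/((x, y) :: pairs (y :: l)) inE => /orP [/eqP [-> ->]//|].
exact: IH.
Qed.

Lemma pairs_cover x l t : x < t <= last x l ->
  exists p q, [/\ (p, q) \in pairs (x :: l), p < t & t <= q].
Proof.
elim: l x => [|y l IH] x /= h; first by lia.
rewrite -[pairs _]/((x, y) :: pairs (y :: l)).
case: (leqP t y) => ty.
  by exists x, y; rewrite mem_head; split=> //; lia.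
have [|p [q [pq pt tq]]] := IH y; first by rewrite ty; case/andP: h.
by exists p, q; rewrite inE pq orbT.
Qed.

Lemma pairs_cat x r y u :
  pairs ((x :: r) ++ y :: u) = pairs (x :: r) ++ (last x r, y) :: pairs (y :: u).
Proof.
elim: r x => [|z r IH] x //.
rewrite -[pairs (x :: z :: r)]/((x, z) :: pairs (z :: r)) /= -IH.
by [].
Qed.

Lemma mem_moves_pairs n s k l ij : layer_ok n s k l ->
  (ij \in moves l) = (ij \in pairs (seps l)).
Proof.
case; case: l => -[//|x r] [//|y u] _ _ _ _ _ _ _.
rewrite /seps [in RHS]pairs_cat /moves !inE !mem_cat mem_rev inE.
by rewrite orbA orbC.
Qed.

Lemma moves_dint n s k l p q : layer_ok n s k l -> (p, q) \in moves l -> dint s p.+1 q.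
Proof.
move=> lo; rewrite (mem_moves_pairs _ lo).
exact: (pairs_sorted (layer_sorted lo)).
Qed.

(** The level falls at each separator [R], and afterwards rises at each
    separator [U]; so a Dyck factor of the layer cannot cross a separator. *)
Lemma sepR_lev s x l y t : path (fun p q => dint s p.+1 q) x l ->
  (forall p, p \in x :: l -> p < size s /\ nth U s p = R) ->
  y \in l -> x < t <= y -> lev s y <= lev s t.
Proof.
elim: l x t => // z l IH x t /= /andP [/dintP [xz e h] pz] hR yl xty.
have low t' : x < t' <= z -> lev s z <= lev s t' by rewrite -e; apply: h.
have [zs zR] : z < size s /\ nth U s z = R by apply: hR; rewrite !inE eqxx orbT.
move: yl; rewrite inE => /orP [/eqP ey|yl]; first by rewrite ey; apply: low; rewrite -ey.
have {}IH t' : z < t' <= y -> lev s y <= lev s t'.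
  by move=> zt; apply: (IH z) => // p pl; apply: hR; rewrite inE pl orbT.
case: (leqP t z) => tz; last by apply: IH; lia.
have := low t ltac:(lia).
have zy : z < y.
  have : path ltn z l by apply: sub_path pz => p q /and3P [].
  by rewrite path_sortedE; [case/andP=> /allP /(_ _ yl)|exact: ltn_trans].
have := IH z.+1 ltac:(lia); have := levR zs zR; lia.
Qed.

Lemma sepU_lev s x l y t : path (fun p q => dint s p.+1 q) x l ->
  (forall p, p \in x :: l -> p < size s /\ nth U s p = U) ->
  y \in x :: l -> y < t <= last x l -> lev s y.+1 <= lev s t.
Proof.
elim: l x y => [|z l IH] x y /=.
  by move=> _ _; rewrite inE => /eqP ->; lia.
move=> /andP [/dintP [xz e h] pz] hU yl yt.
have hU' p : p \in z :: l -> p < size s /\ nth U s p = U.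
  by move=> pl; apply: hU; rewrite inE pl orbT.
move: yl; rewrite inE => /orP [/eqP ey|yl]; last exact: IH pz hU' yl yt.
subst y; case: (leqP t z) => tz; first by apply: h; lia.
have := IH z z pz hU' (mem_head _ _) ltac:(lia).
have [zs zU] := hU' z (mem_head _ _); have := levU zs zU; lia.
Qed.

Lemma layer_factor n s k l a b : layer_ok n s k l -> dint s a b ->
  head 0 l.1 < a -> b <= last 0 l.2 ->
  exists p q, [/\ (p, q) \in moves l, p < a & b <= q].
Proof.
move=> lo /dintP [ab e h] la bl.
have [p [q [pq pa aq]]] : exists p q, [/\ (p, q) \in pairs (seps l), p < a & a <= q].
  case: lo la bl; case: l => -[//|x r] [//|y u] _ _ _ _ _ _ _ /= la bl.
  by apply: pairs_cover; rewrite la last_cat /=; lia.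
exists p, q; rewrite (mem_moves_pairs _ lo); split=> //.
rewrite leqNgt; apply/negP => qb.
have [_ qs] := mem_pairs pq.
case: lo la bl qs {pq}; case: l => -[//|x r] [//|y u] _ _ hR hU srt _ _ /= la bl.
have [s1 s2] := cat_sorted2 srt.
rewrite /seps mem_cat => /orP [qR|qU].
  have [qs qr] := hR _ qR; have := levR qs qr.
  have := h q.+1 ltac:(lia).
  move: qR; rewrite inE => /orP [/eqP|qr']; first by lia.
  have := @sepR_lev s x r q a s1 hR qr' ltac:(lia); lia.
have [qs qu] := hU _ qU; have := levU qs qu; have := h q ltac:(lia).
have := @sepU_lev s y u q b s2 hU qU ltac:(lia); lia.
Qed.

(** * Clearing the region above the path *)

(** The condition [just_above] with the region above the current path in place
    of the path. *)
Definition lowest_in n (A d : {set box n}) : Prop :=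
  d \subset A /\
  forall b c : box n, c \in d -> b \in A -> c.1 <= b.1 -> b.2 <= c.2 -> b \in d.

Lemma lowest_in_sub n (A B d : {set box n}) :
  lowest_in A d -> B \subset A -> d \subset B -> lowest_in B d.
Proof.
move=> [_ h] BA dB; split=> // b c cd /(subsetP BA); exact: h.
Qed.

Definition tile := (nat * (nat * nat))%type.

Section Clearing.

Variables (n : nat) (P : seq step).

Notation cells := (@cells n P).

Definition tile_cells (e : tile) := cells e.1 e.2.1 e.2.2.
Definition tile_fits (e : tile) := fits n P e.1 e.2.1 e.2.2.

(** A removal order for the tiles [L], starting from the region [A] and leaving
    [B]; only the regions above the successive paths matter. *)
Fixpoint clears (A : {set box n}) (L : seq tile) (B : {set box n}) : Prop :=
  if L is e :: L' then
    lowest_in A (tile_cells e) /\ clears (A :\: tile_cells e) L' B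
  else A = B.

Lemma clears_cat A B C L1 L2 :
  clears A L1 B -> clears B L2 C -> clears A (L1 ++ L2) C.
Proof. by elim: L1 A => [A ->|e L1 IH A [le cl]] //= cL2; split=> //; exact: IH. Qed.

Lemma clears_cells_sub A B (L : seq tile) e : clears A L B -> e \in L -> tile_cells e \subset A.
Proof.
elim: L A => // f L IH A [[fA _] cl]; rewrite inE => /orP [/eqP -> //|eL].
by apply: subset_trans (IH _ cl eL) _; apply: subsetDl.
Qed.

Hypothesis lP : lattice_path n P.

Lemma clears_uniq A B (L : seq tile) : (forall e, e \in L -> tile_fits e) -> clears A L B ->
  uniq (map tile_cells L).
Proof.
elim: L A => //= e L IH A fL [le cl].
rewrite (IH _ _ cl) => [|f fin]; last by apply: fL; rewrite inE fin orbT.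
rewrite andbT; apply/mapP => -[f fin ef].
have := clears_cells_sub cl fin; rewrite -ef subsetD => /andP [_].
rewrite -setI_eq0 setIid.
by apply/negP/cells_n0 => //; apply: fL; rewrite mem_head.
Qed.

Lemma clears_partition A (L : seq tile) : (forall e, e \in L -> tile_fits e) ->
  clears A L set0 -> partition [set:: map tile_cells L] A.
Proof.
elim: L A => [|e L IH] A fL /=.
  move=> ->; rewrite (_ : [set:: _] = set0); last by apply/setP => x; rewrite !inE.
  by rewrite partition_set0.
move=> [[eA _] cl].
have fL' f : f \in L -> tile_fits f by move=> fin; apply: fL; rewrite inE fin orbT.
rewrite set_cons -[A](setID _ (tile_cells e)) (setIidPr eA).
apply: partitionU1; first exact: IH.
  by apply: cells_n0 => //; apply: fL; rewrite mem_head.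
by rewrite -setI_eq0 setIDA setDIl setDv set0I.
Qed.

(** * Removing one layer *)

(** The boxes that can be translated [k] times south-east above the path. *)
Definition depth k : {set box n} := [set b : box n | b.1 + k < nR P (antidiag b)].

(** While the lowest layer of [depth k] is being removed, the boxes that are
    gone from it are those on an interval of antidiagonals. *)
Definition region k i j : {set box n} :=
  [set b in depth k | ~~ (((b.1 + k).+1 == nR P (antidiag b)) && (i < antidiag b <= j))].

Lemma in_depth k (b : box n) : (b \in depth k) = (b.1 + k < nR P (antidiag b)).
Proof. by rewrite inE. Qed.

Lemma in_region k i j (b : box n) : (b \in region k i j) =
  (b.1 + k < nR P (antidiag b)) &&
  ~~ (((b.1 + k).+1 == nR P (antidiag b)) && (i < antidiag b <= j)).
Proof. by rewrite !inE. Qed.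

Let szP : size P = n + n := lattice_path_size lP.

Let antidiag_lt (b : box n) : antidiag b < size P.
Proof. by rewrite szP; have := ltn_ord b.1; have := ltn_ord b.2; lia. Qed.

Lemma layer_range k l t : layer_ok n P k l -> t < size P ->
  (head 0 l.1 < t <= last 0 l.2) = (k < nR P t) && (nU P t + k < n).
Proof.
move=> lo tP; have [hs hR] := layer_R lo (layer_head_in lo).
have [ls lU] := layer_U lo (layer_last_in lo).
have hk := layer_first lo; have lk := layer_last lo.
congr andb; apply/idP/idP => h.
- by have := nR_le P h; rewrite nRS // hR eqxx hk; lia.
- by rewrite ltnNge; apply/negP => le; have := nR_le P le; rewrite hk; lia.
- by have := nU_le P h; lia.
- rewrite leqNgt; apply/negP => lt.
  by have := nU_le P lt; rewrite nUS // lU eqxx; lia.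
Qed.

Lemma moves_fits k l p q : layer_ok n P k l -> (p, q) \in moves l -> fits n P k p q.
Proof.
move=> lo pqm; have [/= ps qs] := mem_moves lo pqm.
have /and3P [pq _ _] := moves_dint lo pqm.
have qP := layer_size lo qs; have h1 := layer_head_le lo ps.
have h2 := layer_last_ge lo qs.
split=> //; first by rewrite -szP.
move=> t ht; have := @layer_range k l t lo ltac:(lia).
have -> : head 0 l.1 < t <= last 0 l.2 by lia.
by move=> /esym /andP.
Qed.

(** The interval of cleared antidiagonals grows by a tile that is adjacent to
    it, or starts with one. A box south-east of a box of the tile has to be in
    the same layer, and the steps between their antidiagonals are all [R] or
    all [U]; so it is in the tile, beyond a step of the wrong kind, or
    cleared. *)
Lemma lowest_in_region k l i j p q : layer_ok n P k l -> p < q -> q < size P ->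
  nth U P q = U \/ q = i /\ j = last 0 l.2 ->
  nth U P p = R \/ [/\ p = j, i <= j & nth U P i = R] ->
  q <= i \/ j <= p ->
  lowest_in (region k i j) (cells k p q).
Proof.
move=> lo pq qP hq hp hij; split.
  apply/subsetP => b; rewrite in_cells in_region => /andP [ht /eqP e1].
  by rewrite -e1 ltnSn eqxx !andTb; lia.
move=> b c; rewrite !in_cells in_region => /andP [ht /eqP ec] /andP [db nb] le1 le2.
have ct := antidiag_lt c; have bt := antidiag_lt b.
have sc := nRUE (ltnW ct); have sb := nRUE (ltnW bt).
have b2 := ltn_ord b.2.
move: ht ec db nb ct bt sc sb.
set t := antidiag c; set t' := antidiag b => ht ec db nb ct bt sc sb.
have et : t = (c.1 + c.2).+1 by []; have et' : t' = (b.1 + b.2).+1 by [].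
have [up dn] : (t <= t' -> nU P t' <= nU P t) /\ (t' <= t -> nR P t <= nR P t').
  by split=> h; [have := nR_le P h|have := nU_le P h]; lia.
have eb : (b.1 + k).+1 = nR P t'.
  case: (leqP t t') => h; first by have := nU_le P h; have := up h; lia.
  by have := nR_le P (ltnW h); have := dn (ltnW h); lia.
rewrite eb eqxx andbT; move: nb; rewrite eb eqxx andTb => nb.
have [t'q|qt'] := leqP t' q; last first.
  case: hq => [qU|[qi jl]].
    have := nU_le P (leq_trans (proj2 (andP ht)) (leqnn q)).
    have := nU_le P qt'; rewrite nUS // qU eqxx; have := up ltac:(lia); lia.
  have := layer_range lo bt; have -> : (k < nR P t') && (nU P t' + k < n) by lia.
  by move=> rg; exfalso; move: nb; rewrite jl -qi qt'; move/andP: rg => [_ ->].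
rewrite andbT ltnNge; apply/negP => t'p.
case: hp => [pR|[pj ij iR]].
  have := nR_le P t'p; have := @nR_le P p.+1 t ltac:(lia).
  by rewrite nRS ?pR ?eqxx; [have := dn ltac:(lia)|]; lia.
have t'i : t' <= i by move: nb; lia.
have := nR_le P t'i; have := @nR_le P i.+1 t ltac:(lia).
by rewrite nRS ?iR ?eqxx; [have := dn ltac:(lia)|]; lia.
Qed.

Lemma region_start k i p q : p < q -> region k i i :\: cells k p q = region k p q.
Proof.
move=> pq; apply/setP => b; rewrite in_setD in_cells !in_region.
have -> : i < antidiag b <= i = false by lia.
by rewrite andbF andbT andbC; congr (_ && ~~ _); rewrite andbC.
Qed.

Lemma region_up k i j q : i <= j -> j < q ->
  region k i j :\: cells k j q = region k i q.
Proof.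
move=> ij jq; apply/setP => b; rewrite in_setD in_cells !in_region.
by case: (_ == nR P _); lia.
Qed.

Lemma region_down k i j p : p < i -> i <= j ->
  region k i j :\: cells k p i = region k p j.
Proof.
move=> pi ij; apply/setP => b; rewrite in_setD in_cells !in_region.
by case: (_ == nR P _); lia.
Qed.

Lemma clears_up k i x u : path ltn x u -> i < x ->
  (forall p q, (p, q) \in pairs (x :: u) -> lowest_in (region k i p) (cells k p q)) ->
  clears (region k i x) [seq (k, m) | m <- pairs (x :: u)] (region k i (last x u)).
Proof.
elim: u x => // y u IH x /andP [xy yu] ix.
rewrite -[pairs (x :: y :: u)]/((x, y) :: pairs (y :: u)) => h.
split; first by apply: h; rewrite mem_head.
rewrite /tile_cells /= region_up ?(ltnW ix) //; apply: IH => //.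
  exact: ltn_trans xy.
by move=> p q pq; apply: h; rewrite inE pq orbT.
Qed.

Lemma clears_down k j x r : path ltn x r -> last x r <= j ->
  (forall p q, (p, q) \in pairs (x :: r) -> lowest_in (region k q j) (cells k p q)) ->
  clears (region k (last x r) j) [seq (k, m) | m <- rev (pairs (x :: r))]
    (region k x j).
Proof.
elim: r x => // y r IH x /andP [xy yr] lj.
rewrite -[pairs (x :: y :: r)]/((x, y) :: pairs (y :: r)) => h.
rewrite rev_cons map_rcons -cats1; apply: clears_cat.
  by apply: IH => // p q pq; apply: h; rewrite inE pq orbT.
split; first by apply: h; rewrite mem_head.
rewrite /tile_cells /= region_down //; apply: leq_trans lj.
case/lastP: r yr {IH h} => // r z yz; rewrite last_cons last_rcons ltnW //.
have : path ltn y (rcons r z) by [].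
rewrite path_sortedE; last exact: ltn_trans.
by case/andP=> /allP /(_ z); rewrite mem_rcons mem_head => /(_ isT).
Qed.

Lemma clears_layer k l : layer_ok n P k l ->
  clears (depth k) [seq (k, m) | m <- moves l] (depth k.+1).
Proof.
move=> lo; have lt := layer_lt lo; have les := @layer_last_ge _ _ _ _ _ lo.
have szs := @layer_size _ _ _ _ _ lo.
have rg t := @layer_range k l t lo.
have e1 i : depth k = region k i i.
  apply/setP => b; rewrite in_region in_depth; have -> : i < antidiag b <= i = false by lia.
  by rewrite andbF andbT.
have e2 : depth k.+1 = region k (head 0 l.1) (last 0 l.2).
  apply/setP => b; rewrite in_region in_depth rg //.
  have := nRUE (ltnW (antidiag_lt b)); have := ltn_ord b.2.
  by case: eqP; lia.
have mp := mem_moves_pairs _ lo.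
have lowest i j p q := @lowest_in_region k l i j p q lo.
rewrite {}e2 (e1 (last 0 l.1)) {e1 rg}.
have pq_lt p q : (p, q) \in pairs (seps l) -> p < q := pairs_sorted lt.
case: lo lt lowest mp les szs pq_lt; case: l => -[//|x r] [//|y u] _ _ hR hU _ _ _.
rewrite /seps pairs_cat [(_, _).1]/= [(_, _).2]/= in hR hU *.
move=> lt lowest _ les szs pq_lt.
have [ry [xr yu]] : last x r < y /\ path ltn x r /\ path ltn y u.
  by move: lt; rewrite /= cat_path /= => /and3P [].
have rin : last x r \in x :: r by exact: mem_last.
have [rs rR] := hR _ rin.
have yin : y \in y :: u by exact: mem_head.
have [ys yU] := hU _ yin.
have inR p : p \in x :: r -> p \in (x :: r) ++ y :: u by rewrite mem_cat => ->.
have inU p : p \in y :: u -> p \in (x :: r) ++ y :: u by rewrite mem_cat => ->; rewrite orbT.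
have ylast : last x r < last y u.
  by apply: leq_trans (les _ (inU _ yin)).
rewrite [head _ _]/= [last _ _]/= map_cons map_cat; split.
  by apply: lowest => //; [left|left|right].
rewrite /tile_cells [(_, _).1]/= [(_, _).2]/= [(_, _).1]/= region_start //.
apply: (clears_cat (B := region k (last x r) (last y u))).
  apply: clears_up => // p q pq.
  have [pin qin] := mem_pairs pq; have [qs qU] := hU _ qin.
  have yp : y <= p.
    move: pin; rewrite inE => /orP [/eqP ->//|pu].
    by move: yu; rewrite path_sortedE; [case/andP=> /allP /(_ _ pu) /ltnW|exact: ltn_trans].
  apply: lowest.
  - by apply: pq_lt; rewrite mem_cat inE pq !orbT.
  - by [].
  - by left.
  - by right; split=> //; apply: ltnW (leq_trans ry yp).
  - by right.
apply: clears_down => //; first exact: ltnW.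
move=> p q pq; have [pin qin] := mem_pairs pq; have [ps pR] := hR _ pin.
have [qs _] := hR _ qin.
apply: lowest.
- by apply: pq_lt; rewrite mem_cat pq.
- by [].
- by right.
- by left.
- by left.
Qed.

End Clearing.

(** * The maximal cover-inclusive tiling *)

Definition tiles (lay : nat -> layer) K : seq tile :=
  flatten [seq [seq (k, m) | m <- moves (lay k)] | k <- iota 0 K].

Lemma tilesS lay K :
  tiles lay K.+1 = tiles lay K ++ [seq (K, m) | m <- moves (lay K)].
Proof. by rewrite /tiles -addn1 iotaD map_cat flatten_cat /= cats0. Qed.

Lemma tiles_moves lay K : map snd (tiles lay K) = all_moves lay K.
Proof.
elim: K => // K IH; rewrite tilesS all_movesS map_cat IH -map_comp.
by congr (_ ++ _); rewrite -[RHS]map_id; apply: eq_map.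
Qed.

Lemma mem_tiles lay K k m :
  ((k, m) \in tiles lay K) = (k < K) && (m \in moves (lay k)).
Proof.
elim: K => // K IH; rewrite tilesS mem_cat {}IH.
have -> : ((k, m) \in [seq (K, m) | m <- moves (lay K)])
    = (k == K) && (m \in moves (lay K)).
  apply/mapP/andP => [[m' mm [-> ->]]|[/eqP -> mm]]; first by rewrite eqxx.
  by exists m.
rewrite [k < K.+1]ltnS [k <= K]leq_eqVlt; case: eqP => [->|_].
  by rewrite ltnn.
by rewrite andFb orbF.
Qed.

Lemma partition_refine_eq (T : finType) (A B : {set {set T}}) (D : {set T}) :
  partition A D -> partition B D ->
  (forall d, d \in A -> exists2 e, e \in B & d \subset e) ->
  (forall d, d \in B -> exists2 e, e \in A & d \subset e) -> A = B.
Proof.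
have sub (A1 B1 : {set {set T}}) : partition A1 D ->
    (forall d, d \in A1 -> exists2 e, e \in B1 & d \subset e) ->
    (forall d, d \in B1 -> exists2 e, e \in A1 & d \subset e) -> A1 \subset B1.
  move=> pA h1 h2; apply/subsetP => d dA.
  have [e eB de] := h1 _ dA; have [f fA ef] := h2 _ eB.
  have df : d = f.
    apply/eqP; apply: contraT => ne.
    have /trivIsetP /(_ _ _ dA fA ne) : trivIset A1 by case/and3P: pA.
    rewrite -setI_eq0 (setIidPl (subset_trans de ef)).
    by rewrite (negbTE (partition_neq0 pA dA)).
  by have -> : d = e by apply/eqP; rewrite eqEsubset de df ef.
by move=> pA pB h1 h2; apply/eqP; rewrite eqEsubset !sub.
Qed.

Section Tiling.

Variables (n : nat) (P : seq step).
Hypothesis dP : dyck_path n P.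
Let lP : lattice_path n P := dP.1.
Let szP : size P = n + n := lattice_path_size lP.
Let K := nR P n.

Variable lay : nat -> layer.
Hypothesis lay_ok : forall k, k < K -> layer_ok n P k (lay k).

Let antidiag_lt (b : box n) : antidiag b < size P.
Proof. by rewrite szP; have := ltn_ord b.1; have := ltn_ord b.2; lia. Qed.

Lemma tiles_fit e : e \in tiles lay K -> tile_fits n P e.
Proof.
case: e => k [p q]; rewrite mem_tiles => /andP [kK pq].
exact: (moves_fits lP (lay_ok kK) pq).
Qed.

(** A point [t] in the first half has at most [K] steps [R] before it, and one in
    the second half at most [K] steps [U] after it. *)
Lemma in_layer_lt k t : t < size P -> k < nR P t -> nU P t + k < n -> k < K.
Proof.
move=> tP kR kU; rewrite ltnNge; apply/negP => Kk.
have sn := @nRUE P n ltac:(lia); have st := nRUE (ltnW tP).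
by case: (leqP t n) => h; [have := nR_le P h|have := nU_le P (ltnW h)]; lia.
Qed.

Lemma clears_tiles : clears P (above n P) (tiles lay K) set0.
Proof.
have -> : above n P = depth n P 0.
  by apply/setP => b; rewrite in_above // in_depth addn0.
have -> : set0 = depth n P K.
  apply/setP => b; rewrite in_set0 in_depth; apply/esym/negbTE/negP => h.
  have bt := antidiag_lt b; have b2 := ltn_ord b.2; have st := nRUE (ltnW bt).
  have := @in_layer_lt K _ bt ltac:(lia) ltac:(lia); by rewrite ltnn.
suff h j : j <= K -> clears P (depth n P 0) (tiles lay j) (depth n P j) by exact: h.
elim: j => // j IH jK; rewrite tilesS; apply: clears_cat (IH (ltnW jK)) _.
by apply: clears_layer => //; apply: lay_ok.
Qed.

Definition max_tiling : {set {set box n}} := [set:: map (tile_cells n P) (tiles lay K)].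

Lemma in_max_tiling d : d \in max_tiling ->
  exists k p q, [/\ k < K, (p, q) \in moves (lay k) & d = cells n P k p q].
Proof.
rewrite in_set => /mapP [[k [p q]] + ->].
by rewrite mem_tiles => /andP [kK pq]; exists k, p, q.
Qed.

Lemma max_tiling_in k p q : k < K -> (p, q) \in moves (lay k) ->
  cells n P k p q \in max_tiling.
Proof.
move=> kK pq; rewrite in_set; apply/mapP; exists (k, (p, q)) => //.
by rewrite mem_tiles kK.
Qed.

Lemma max_tiling_dyck : dyck_tiling P max_tiling.
Proof.
split; first exact: (clears_partition lP tiles_fit clears_tiles).
move=> d /in_max_tiling [k [p [q [kK pq ->]]]].
have lo := lay_ok kK.
exact: (cells_dyck_tile lP (moves_fits lP lo pq) (moves_dint lo pq)).
Qed.

Lemma in_shiftSE (d : {set box n}) (b c : box n) : b \in d ->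
  c.1 = b.1.+1 :> nat -> c.2.+1 = b.2 :> nat -> c \in shiftSE d.
Proof.
move=> bd e1 e2; rewrite inE; apply/existsP; exists b; rewrite bd /=.
by apply/andP; split; apply/eqP.
Qed.

Lemma shiftSE_ex (d : {set box n}) (c : box n) : c \in shiftSE d ->
  exists2 b, b \in d & c.1 = b.1.+1 :> nat /\ c.2.+1 = b.2 :> nat.
Proof.
by rewrite inE => /existsP [b /and3P [bd /eqP e1 /eqP e2]]; exists b.
Qed.

(** The word of a layer is a factor of the word of the layer below, whose
    maximal Dyck factors are therefore larger. *)
Lemma max_tiling_cover_inclusive : cover_inclusive P max_tiling.
Proof.
move=> d /in_max_tiling [k [p [q [kK pq ->]]]].
have lo := lay_ok kK; have [pltq qn _] := moves_fits lP lo pq.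
case: k kK pq lo => [|k] kK pq lo.
  left; rewrite -setI_eq0; apply/eqP/setP => c; rewrite in_setI in_set0.
  apply/negbTE/negP => /andP [/shiftSE_ex [b + [e1 e2]]].
  rewrite in_cells in_above // => /andP [_ /eqP eb].
  have -> : antidiag c = antidiag b by lia.
  by rewrite e1 -eb; lia.
right; have lo' := lay_ok (ltnW kK).
have [hs _] := layer_R lo (layer_head_in lo).
have [hs' hR'] := layer_R lo' (layer_head_in lo').
have [ls lU] := layer_U lo (layer_last_in lo).
have [ls' _] := layer_U lo' (layer_last_in lo').
have [ps qs] := mem_moves lo pq.
have head_lt : head 0 (lay k).1 < head 0 (lay k.+1).1.
  rewrite ltnNge; apply/negP => h.
  by have := nR_le P h; rewrite (layer_first lo) (layer_first lo'); lia.
have last_lt : last 0 (lay k.+1).2 < last 0 (lay k).2.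
  rewrite ltnNge; apply/negP => h.
  by have := nU_le P h; have := layer_last lo; have := layer_last lo'; lia.
have h1 := layer_head_le lo ps; have h2 := layer_last_ge lo qs.
have [p' [q' [pq' pp qq]]] := layer_factor lo' (moves_dint lo pq)
  ltac:(move: h1 => /=; lia) ltac:(move: h2 => /=; lia).
exists (cells n P k p' q'); first by apply: max_tiling_in => //; apply: ltnW.
apply/subsetP => c /shiftSE_ex [b + [e1 e2]].
rewrite !in_cells => /andP [hb /eqP eb].
have -> : antidiag c = antidiag b by lia.
by apply/andP; split; [|rewrite -eb e1; apply/eqP]; lia.
Qed.

Section Refine.

Variable T : {set {set box n}}.
Hypotheses (dT : dyck_tiling P T) (cT : cover_inclusive P T).

Let T_above d c : d \in T -> c \in d -> c.1 < nR P (antidiag c).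
Proof.
move=> dinT cd; rewrite -in_above // -(cover_partition dT.1).
by apply/bigcupP; exists d.
Qed.

Lemma above_dyck t : nR P t <= nU P t.
Proof. by case: dP => _ []. Qed.

Let shift_in d c : d \in T -> c \in d ->
  exists c', [/\ c' \in shiftSE d, c'.1 = c.1.+1 :> nat & antidiag c' = antidiag c].
Proof.
move=> dinT cd; have ca := T_above dinT cd.
have sc := nRUE (ltnW (antidiag_lt c)); have := above_dyck (antidiag c).
have c2 := ltn_ord c.2 => ud.
have [] := @box_ex n c.1.+1 c.2.-1; [lia|lia|move=> c' [e1 e2]].
exists c'; split=> //; last by lia.
by apply: in_shiftSE cd e1 _; lia.
Qed.

(** The translate of a tile lies either outside the region or in one tile, and
    by induction the boxes of the latter are in one layer. *)
Lemma cover_inclusive_depth k d b c : d \in T -> b \in d -> c \in d ->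
  (b.1 + k).+1 = nR P (antidiag b) -> (c.1 + k).+1 = nR P (antidiag c).
Proof.
elim: k d b c => [|k IH] d b c dinT bd cd eb; case: (cT dinT) => [dis|[d2 d2T sub]].
- have ca := T_above dinT cd; apply/eqP; rewrite eqn_leq addn0 ca leqNgt.
  apply/negP => lt; have [c' [c'd e1 e2]] := shift_in dinT cd.
  by have := disjointFr dis c'd; rewrite in_above // e2 e1 lt.
- have [b' [b'd e1 e2]] := shift_in dinT bd.
  have := T_above d2T (subsetP sub _ b'd); rewrite e2 e1; lia.
- have [b' [b'd e1 e2]] := shift_in dinT bd.
  have := disjointFr dis b'd; rewrite in_above // e2 e1.
  by have -> : b.1.+1 < nR P (antidiag b) by lia.
have [b' [b'd e1 e2]] := shift_in dinT bd.
have [c' [c'd e3 e4]] := shift_in dinT cd.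
have := IH d2 b' c' d2T (subsetP sub _ b'd) (subsetP sub _ c'd).
rewrite e2 e1 e4 e3; lia.
Qed.

Lemma cover_inclusive_refines d : d \in T -> exists2 e, e \in max_tiling & d \subset e.
Proof.
move=> dinT; have [D [x [y [bs [[cD hD] ebs ed]]]]] := dT.2 _ dinT.
have szD : nR D (size D) = nU D (size D) by rewrite nR_size nU_size.
have ex j : j <= size D -> exists c, [/\ c \in d, c.1 = x + nR D j :> nat
    & c.2 = y + nU D j :> nat].
  move=> jD; have : (x + nR D j, y + nU D j) \in [seq corner b | b <- bs].
    by rewrite ebs; apply/mapP; exists j; rewrite // mem_iota; lia.
  move=> /mapP [c cbs ec]; exists c; rewrite ed inE cbs; split=> //.
    exact: esym (congr1 fst ec).
  exact: esym (congr1 snd ec).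
have all_ex c : c \in d -> exists j, [/\ j <= size D, c.1 = x + nR D j :> nat
    & c.2 = y + nU D j :> nat].
  rewrite ed inE => cbs; have := map_f (@corner n) cbs; rewrite ebs.
  move=> /mapP [j]; rewrite mem_iota ltnS => /andP [_ jD] ec; exists j; split=> //.
    exact: (congr1 fst ec).
  exact: (congr1 snd ec).
have sD j : j <= size D -> nR D j + nU D j = j by exact: nRUE.
have [c0 [c0d c01 c02]] := ex 0 (leq0n _).
have pos0 : nR D 0 = 0 /\ nU D 0 = 0 by rewrite /= take0.
have a0 := T_above dinT c0d.
(* The depth of the bottom left box, hence of the whole tile. *)
pose k := nR P (antidiag c0) - c0.1.+1.
have ek : (c0.1 + k).+1 = nR P (antidiag c0) by rewrite /k; lia.
pose a := (x + y).+1; pose b := a + size D.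
have at_j j : j <= size D -> [/\ nR P (a + j) = (x + nR D j + k).+1, a + j < size P
    & nU P (a + j) + k < n /\ nU P (a + j) + k = y + nU D j].
  move=> jD; have [c [cd c1 c2]] := ex j jD.
  have := cover_inclusive_depth dinT c0d cd ek; have := antidiag_lt c.
  have cn := ltn_ord c.2; have sj := sD j jD.
  have -> : antidiag c = a + j by rewrite c1 c2 /a; lia.
  by move=> ajP e; have := nRUE (ltnW ajP); rewrite -e c1; split; lia.
have [ea aP [ua uay]] := at_j 0 (leq0n _); rewrite addn0 in ea aP ua uay.
have [eb bP [ub uby]] := at_j _ (leqnn _).
have kK : k < K by apply: in_layer_lt aP _ ua; rewrite ea; lia.
have lo := lay_ok kK.
have rg t := @layer_range n P lP k (lay k) t lo.
have ra : head 0 (lay k).1 < a <= last 0 (lay k).2.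
  by rewrite rg // ua ea; lia.
have rb : head 0 (lay k).1 < b <= last 0 (lay k).2.
  by rewrite rg // ub eb; lia.
have dab : dint P a b.
  apply/dintP; split; first exact: leq_addr.
    by rewrite /lev /b; lia.
  move=> t /andP [at_ tb]; have -> : t = a + (t - a) by lia.
  have [et tP [_ ut]] := at_j (t - a) ltac:(rewrite /b in tb; lia).
  by have := hD (t - a); rewrite /lev; lia.
have [p [q [pq pa bq]]] := layer_factor lo dab (proj1 (andP ra)) (proj2 (andP rb)).
exists (cells n P k p q); first exact: max_tiling_in.
apply/subsetP => c cd; have [j [jD c1 c2]] := all_ex c cd.
have [ej _ _] := at_j j jD; have sj := sD j jD; rewrite in_cells.
have -> : antidiag c = a + j by rewrite c1 c2 /a; lia.
by rewrite ej c1 eqxx andbT; move: bq; rewrite /b; lia.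
Qed.

End Refine.

Lemma max_tiling_maximal : maximal_tiling P max_tiling.
Proof.
split; [exact: max_tiling_dyck|exact: max_tiling_cover_inclusive|].
move=> S dS cS h; apply/esym.
apply: partition_refine_eq (max_tiling_dyck).1 dS.1 h _.
exact: cover_inclusive_refines.
Qed.

Lemma maximal_tiling_unique T : maximal_tiling P T -> T = max_tiling.
Proof.
case=> dT cT mT; apply/esym; apply: mT.
- exact: max_tiling_dyck.
- exact: max_tiling_cover_inclusive.
- exact: cover_inclusive_refines.
Qed.

End Tiling.

(** * Removing one tile *)

Definition raise s p q : seq step :=
  [seq if i == p then U else if i == q then R else nth U s i | i <- iota 0 (size s)].

Lemma size_raise s p q : size (raise s p q) = size s.
Proof. by rewrite size_map size_iota. Qed.

Lemma stepU s t : t < size s -> nth U s t = U ->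
  nR s t.+1 = nR s t /\ nU s t.+1 = (nU s t).+1.
Proof. by move=> ts e; rewrite nRS // nUS // e eqxx addn1 addn0. Qed.

Lemma stepR s t : t < size s -> nth U s t = R ->
  nR s t.+1 = (nR s t).+1 /\ nU s t.+1 = nU s t.
Proof. by move=> ts e; rewrite nRS // nUS // e eqxx addn1 addn0. Qed.

Lemma nR_raise s p q t : p < q -> q < size s -> nth U s p = R -> nth U s q = U ->
  t <= size s -> nR (raise s p q) t + (p < t <= q) = nR s t.
Proof.
move=> pq qs sp sq; elim: t => [|t IH] ts; first by rewrite /= !take0.
rewrite !nRS ?size_raise // -IH ?(ltnW ts) //.
rewrite (nth_map 0) ?size_iota // nth_iota // add0n.
case: (eqVneq t p) => [->|tp]; first by rewrite sp eqxx (_ : (U == R) = false) //; lia.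
case: (eqVneq t q) => [->|tq]; first by rewrite sq eqxx (_ : (U == R) = false) //; lia.
by case: (_ == R); lia.
Qed.

Section Step.

Variables (n : nat) (P s : seq step) (k p q : nat).
Hypotheses (lP : lattice_path n P) (ls : lattice_path n s).
Hypothesis fit : fits n P k p q.
Let d := cells n P k p q.
Hypothesis low : lowest_in (above n s) d.

Let szs : size s = n + n := lattice_path_size ls.
Let pq : p < q. Proof. by case: fit. Qed.
Let qs : q < size s. Proof. by case: fit; rewrite szs. Qed.

Let nRn t : nR s t <= n.
Proof. by have := nR_le_all s t; rewrite ls.2. Qed.

(** The boxes of the tile touch the path: otherwise the box just south-east of
    one of them would still be there. *)
Lemma tile_rim t : p < t <= q -> nR s t + k = nR P t.
Proof.
move=> ht; have [b [bd bt eb]] := cells_at lP fit ht.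
have := subsetP low.1 _ bd; rewrite in_above // bt => lt.
suff : nR s t <= b.1.+1 by lia.
rewrite leqNgt; apply/negP => lt2; have := nRn t.
have := @nRUE s t ltac:(lia) => st nt; have b2 := ltn_ord b.2.
have [] := @box_ex n b.1.+1 b.2.-1; [lia|lia|move=> c [c1 c2]].
have ct : antidiag c = t by lia.
have cd : c \in d.
  apply: low.2 bd _ _ _; rewrite ?in_above // ?ct; lia.
by move: cd; rewrite in_cells ct => /andP [_ /eqP]; lia.
Qed.

Lemma tile_box b : b \in d -> b.1.+1 = nR s (antidiag b) /\ b.2 = nU s (antidiag b) :> nat.
Proof.
rewrite in_cells => /andP [ht /eqP eb].
have := tile_rim ht; have := @nRUE s (antidiag b) ltac:(lia); lia.
Qed.

(** If the step before the tile were [U], the box below the bottom left box of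
    the tile would still be there; similarly at the other end. *)
Lemma step_before : nth U s p = R.
Proof.
case sp : (nth U s p) => //; exfalso.
have [b [bd bt _]] := @cells_at n P k p q p.+1 lP fit ltac:(rewrite ltnSn pq; lia).
have [b1 b2] := tile_box bd; rewrite bt in b1 b2.
have ps : p < size s by lia.
have b2n := ltn_ord b.2; have b1n := ltn_ord b.1.
have [rS uS] := stepU ps sp.
have [] := @box_ex n b.1 b.2.-1; [lia|lia|move=> c [c1 c2]].
have ct : antidiag c = p by lia.
have cd : c \in d by apply: low.2 bd _ _ _; rewrite ?in_above // ?ct; lia.
by move: cd; rewrite in_cells ct ltnn.
Qed.

Lemma step_after : nth U s q = U.
Proof.
case sq : (nth U s q) => //; exfalso.
have [b [bd bt _]] := @cells_at n P k p q q lP fit ltac:(rewrite pq; lia).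
have [b1 b2] := tile_box bd; rewrite bt in b1 b2.
have [rS _] := stepR qs sq.
have := nRn q.+1 => rn; have b2n := ltn_ord b.2.
have [] := @box_ex n b.1.+1 b.2; [lia|lia|move=> c [c1 c2]].
have ct : antidiag c = q.+1 by lia.
have cd : c \in d by apply: low.2 bd _ _ _; rewrite ?in_above // ?ct; lia.
by move: cd; rewrite in_cells ct ltnn andbF.
Qed.

Lemma lattice_path_raise : lattice_path n (raise s p q).
Proof.
have eR : count_mem R (raise s p q) = n.
  have := nR_raise pq qs step_before step_after (leqnn _).
  have -> : p < size s <= q = false by lia.
  by rewrite addn0 nR_size ls.2 -(size_raise s p q) nR_size.
split=> //; have := count_step (raise s p q); rewrite size_raise szs eR; lia.
Qed.

Lemma above_raise : above n (raise s p q) = above n s :\: d.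
Proof.
apply/setP => b; rewrite in_setD !in_above //; last exact: lattice_path_raise.
have b1 := ltn_ord b.1; have b2 := ltn_ord b.2; rewrite in_cells.
have := @nR_raise s p q (antidiag b) pq qs step_before step_after ltac:(lia).
case ht : (p < _ <= q); last by rewrite addn0 => ->.
have := tile_rim ht => e1 e2; rewrite -e1 -e2 andTb.
by case: eqP => e; lia.
Qed.

Lemma lowest_raise : lowest_path_above s d (raise s p q).
Proof.
split; first split.
- exact: lattice_path_raise.
- by rewrite above_raise subsetDl.
- by rewrite above_raise -setI_eq0 setIDA setDIl setDv set0I.
by move=> s'' [_ sub dis]; rewrite above_raise subsetD sub disjoint_sym.
Qed.

Lemma lowest_path_above_eq s' : lowest_path_above s d s' ->
  lattice_path n s' /\ above n s' = above n s :\: d.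
Proof.
case=> [[ls' sub dis] h]; split=> //; apply/eqP; rewrite eqEsubset.
rewrite subsetD sub disjoint_sym dis /= -above_raise.
by apply: h; case: lowest_raise.
Qed.

Lemma tile_steps_ends : tile_steps s d p q.
Proof.
have [b [bd bt _]] := @cells_at n P k p q p.+1 lP fit ltac:(rewrite ltnSn pq; lia).
have [c [cd ct _]] := @cells_at n P k p q q lP fit ltac:(rewrite pq; lia).
have [b1 b2] := tile_box bd; have [c1 c2] := tile_box cd; rewrite bt in b1 b2; rewrite ct in c1 c2.
have inT (e : box n) : e \in d -> p < antidiag e <= q.
  by rewrite in_cells => /andP [].
exists b, c; split.
- split=> // e ed; have [e1 e2] := tile_box ed; have := inT e ed => /andP [h1 h2].
  by have := nR_le s h1; have := nU_le s h1; lia.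
- split=> // e ed; have [e1 e2] := tile_box ed; have := inT e ed => /andP [h1 h2].
  by have := nR_le s h2; have := nU_le s h2; lia.
- have ps : p < size s by lia.
  have [rS uS] := stepR ps step_before.
  have e1 : nR s p = b.1 by lia.
  have e2 : nU s p = b.2 by lia.
  rewrite /is_step ps step_before eqxx /=; apply/eqP; congr pair.
    exact: e1.
  exact: e2.
rewrite /is_step qs step_after eqxx /=; apply/eqP; congr pair.
  exact: esym c1.
exact: esym c2.
Qed.

Lemma tile_steps_eq i j : tile_steps s d i j -> i = p /\ j = q.
Proof.
have pt i' c x y : is_step s i' c (x, y) -> i' = x + y.
  move=> /and3P [is_ _ /eqP e]; rewrite -(nRUE (ltnW is_)).
  by rewrite -(congr1 fst e : nR s i' = x) -(congr1 snd e : nU s i' = y).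
move=> [b [e [[bd bmin] [ed emax] /pt ei /pt ej]]].
have [b' [e' [[b'd b'min] [e'd e'max] /pt pe /pt qe]]] := tile_steps_ends.
have [h1 h2] := bmin _ b'd; have [h3 h4] := b'min _ bd.
have [h5 h6] := emax _ e'd; have [h7 h8] := e'max _ ed.
have ebb : b = b' by apply: box_inj; lia.
have eee : e = e' by apply: box_inj; lia.
by rewrite ei ej pe qe ebb eee.
Qed.

End Step.

(** * Runs *)

Lemma swap_comm p q p' q' x : p != p' -> p != q' -> q != p' -> q != q' ->
  swap p q (swap p' q' x) = swap p' q' (swap p q x).
Proof. by rewrite /swap; repeat case: eqP; lia. Qed.

Lemma val_tperm m (i j x : 'I_m) : tperm i j x = swap i j x :> nat.
Proof.
rewrite /swap; case: tpermP => [->|->|/eqP xi /eqP xj]; rewrite ?eqxx //.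
  by case: eqP.
by rewrite -!(inj_eq val_inj) in xi xj *; rewrite (negbTE xi) (negbTE xj).
Qed.

Section Runs.

Variables (n : nat) (P : seq step).
Hypothesis lP : lattice_path n P.
Notation cells := (tile_cells n P).
Notation all_fit := (fun L : seq tile => forall e, e \in L -> tile_fits n P e).

(** Both tiles touch the path. If they started at the same step, they would
    share the box there; and the step before a tile is [R], while the step
    after a tile is [U]. *)
Lemma lowest_swap_comm s e f x : lattice_path n s ->
  tile_fits n P e -> tile_fits n P f ->
  lowest_in (above n s) (cells e) -> lowest_in (above n s) (cells f) ->
  [disjoint cells e & cells f] ->
  swap e.2.1 e.2.2 (swap f.2.1 f.2.2 x) = swap f.2.1 f.2.2 (swap e.2.1 e.2.2 x).
Proof.
case: e f => k [p q] [k' [p' q']] ls fe ff le lf dis.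
have [pq _ _] := fe; have [pq' _ _] := ff.
have disP t b c : b \in cells (k, (p, q)) -> c \in cells (k', (p', q')) ->
    antidiag b = t -> antidiag c = t -> False.
  move=> be cf bt ct; have [b1 b2] := tile_box lP ls fe le be.
  have [c1 c2] := tile_box lP ls ff lf cf; rewrite bt in b1 b2; rewrite ct in c1 c2.
  have bc : b = c by apply: box_inj; lia.
  by have := disjointFr dis be; rewrite bc cf.
have sp := step_before lP ls fe le; have sp' := step_before lP ls ff lf.
have sq := step_after lP ls fe le; have sq' := step_after lP ls ff lf.
change (swap p q (swap p' q' x) = swap p' q' (swap p q x)).
apply: swap_comm; apply/eqP => e.
- have [b [be bt _]] := @cells_at n P k p q p.+1 lP fe ltac:(rewrite ltnSn pq; lia).
  have [c [cf ct _]] := @cells_at n P k' p' q' p.+1 lP ff ltac:(rewrite e ltnSn pq'; lia).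
  exact: disP be cf bt ct.
- by move: sp; rewrite e sq'.
- by move: sq; rewrite e sp'.
- have [b [be bt _]] := @cells_at n P k p q q lP fe ltac:(rewrite pq; lia).
  have [c [cf ct _]] := @cells_at n P k' p' q' q lP ff ltac:(rewrite e pq'; lia).
  exact: disP be cf bt ct.
Qed.

Lemma raise_state s e : lattice_path n s -> tile_fits n P e ->
  lowest_in (above n s) (cells e) ->
  let s' := raise s e.2.1 e.2.2 in
  lattice_path n s' /\ above n s' = above n s :\: cells e.
Proof.
by case: e => k [p q] ls fe le; split; [apply: lattice_path_raise le|apply: above_raise].
Qed.

(** The tiles that were removed before [e] could all be removed together with
    it, so their transpositions commute with the one of [e]. *)
Lemma clears_front s (L L' : seq tile) e B : lattice_path n s ->
  all_fit (L ++ e :: L') -> clears P (above n s) (L ++ e :: L') B ->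
  lowest_in (above n s) (cells e) ->
  clears P (above n s) (e :: L ++ L') B /\
  forall x, act (map snd (L ++ e :: L')) x = act (map snd (e :: L ++ L')) x.
Proof.
elim: L s => [|f L IH] s ls fit; first by move=> cl _; split.
move=> [lf cl] le.
have ff : tile_fits n P f by apply: fit; rewrite mem_head.
have fit' : all_fit (L ++ e :: L') by move=> g gin; apply: fit; rewrite inE gin orbT.
have fe : tile_fits n P e by apply: fit'; rewrite mem_cat mem_head orbT.
have [ls' as'] := raise_state ls ff lf; rewrite -as' in cl.
have ein : e \in L ++ e :: L' by rewrite mem_cat mem_head orbT.
have esub := clears_cells_sub cl ein.
have le' : lowest_in (above n (raise s f.2.1 f.2.2)) (cells e).
  by apply: lowest_in_sub le _ esub; rewrite as' subsetDl.
have [[_ cl'] ea] := IH _ ls' fit' cl le'.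
have dis : [disjoint cells e & cells f].
  by move: esub; rewrite as' subsetD => /andP [].
split.
  split=> //; split.
    by apply: lowest_in_sub (lf) (subsetDl _ _) _; rewrite subsetD lf.1 disjoint_sym.
  by move: cl'; rewrite as' !setDDl setUC.
move=> x; rewrite /= -/(act (map snd (L ++ e :: L')) _) ea /=.
by rewrite (lowest_swap_comm x ls fe ff le lf dis).
Qed.

(** The first tile of one order can be brought to the front of the other. *)
Lemma clears_act s (L L' : seq tile) B B' : lattice_path n s -> all_fit L ->
  perm_eq L L' -> clears P (above n s) L B -> clears P (above n s) L' B' ->
  forall x, act (map snd L) x = act (map snd L') x.
Proof.
elim: L s L' => [|e L IH] s L' ls fit pe.
  by move: pe; rewrite perm_sym => /perm_nilP ->.
move=> [le cl] cl'.
have eL' : e \in L' by rewrite -(perm_mem pe) mem_head.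
case/splitPr: eL' pe cl' => L1 L2 pe cl'.
have fit' : all_fit (L1 ++ e :: L2) by move=> f; rewrite -(perm_mem pe); apply: fit.
have [[_ cl2] ea] := clears_front ls fit' cl' le.
have fe : tile_fits n P e by apply: fit; rewrite mem_head.
have [ls' as'] := raise_state ls fe le; rewrite -as' in cl cl2.
move=> x; rewrite ea; apply: IH ls' _ _ cl cl2 _.
  by move=> f fin; apply: fit; rewrite inE fin orbT.
by move: pe; rewrite perm_sym -cat1s perm_catCA perm_cons perm_sym.
Qed.

Lemma clears_run s L B (m : {perm 'I_(n + n)}) : lattice_path n s -> all_fit L ->
  clears P (above n s) L B ->
  exists2 t : {perm 'I_(n + n)}, forall x, t x = act (map snd L) x :> nat
    & DT_run s m (map cells L) (m ^ t)%g.
Proof.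
elim: L s m => [|e L IH] s m ls fit /=.
  by exists 1%g => [x|]; [rewrite perm1|rewrite conjg1; apply: DT_nil].
move=> [le cl]; have fe : tile_fits n P e by apply: fit; rewrite mem_head.
have [ls' as'] := raise_state ls fe le; rewrite -as' in cl.
have fit' : all_fit L by move=> f fin; apply: fit; rewrite inE fin orbT.
case: e fe le ls' as' cl {fit} => k [p q] fe le ls' as' cl.
have [pq qn _] := fe; have pn : p < n + n := ltn_trans pq qn.
pose i := Ordinal pn; pose j := Ordinal (qn : q < n + n).
have [t tE run] := IH _ (m ^ tperm i j)%g ls' fit' cl.
exists (tperm i j * t)%g => [x|].
  by rewrite permM tE val_tperm.
rewrite conjgM; apply: DT_cons run; first exact: le.
  exact: lowest_raise lP ls fe le.
exact: tile_steps_ends lP ls fe le.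
Qed.

Lemma run_clears s L (m m' : {perm 'I_(n + n)}) : lattice_path n s -> all_fit L ->
  DT_run s m (map cells L) m' ->
  (exists B, clears P (above n s) L B) /\
  exists2 t : {perm 'I_(n + n)}, forall x, t x = act (map snd L) x :> nat
    & m' = (m ^ t)%g.
Proof.
elim: L s m => [|e L IH] s m ls fit /= run.
  inversion run; split; first by exists (above n s).
  by exists 1%g => [x|]; rewrite ?perm1 ?conjg1.
have fe : tile_fits n P e by apply: fit; rewrite mem_head.
have fit' : all_fit L by move=> f fin; apply: fit; rewrite inE fin orbT.
inversion run as [|s0 m0 d ds s' i j m1 ja lo ts run']; subst.
have le : lowest_in (above n s) (cells e) by exact: ja.
case: e fe le lo ts ja run {fit} => k [p q] fe le lo ts ja run.
have [ls' as'] := lowest_path_above_eq lP ls fe le lo.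
have [ip jq] := tile_steps_eq lP ls fe le ts.
have [[B cl] [t tE ->]] := IH _ _ ls' fit' run'.
split; first by exists B; split=> //; rewrite -as'.
exists (tperm i j * t)%g => [x|]; last by rewrite conjgM.
by rewrite permM tE val_tperm ip jq.
Qed.

End Runs.

(** * Reading the permutation *)

Lemma paren_matched_uniqr s p q q' : q < size s -> q' < size s ->
  paren_matched s p q -> paren_matched s p q' -> q = q'.
Proof.
wlog lt : q q' / q < q' => [H qs qs' h h'|].
  case: (ltngtP q q') => // lt; first exact: H lt qs qs' h h'.
  by apply/esym; exact: H lt qs' qs h' h.
move=> qs qs' /(paren_matchedP _ qs) [pq _ eq /dintP [_ e _]].
move=> /(paren_matchedP _ qs') [_ _ _ /dintP [_ _ /(_ q.+1)]].
by have := levR qs eq; lia.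
Qed.

Lemma paren_matched_uniql s p p' q : q < size s ->
  paren_matched s p q -> paren_matched s p' q -> p = p'.
Proof.
move=> qs; wlog lt : p p' / p < p' => [H h h'|].
  case: (ltngtP p p') => // lt; first exact: H lt h h'.
  by apply/esym; exact: H lt h' h.
move=> /(paren_matchedP _ qs) [pq _ _ /dintP [_ e1 /(_ p')]] h1.
move=> /(paren_matchedP _ qs) [pq' ep' _ /dintP [_ e2 _]].
have := levU (ltn_trans pq' qs) ep'; lia.
Qed.

Lemma partner_ex n P (w : 'S_n) i : code P w -> i < n + n ->
  exists2 j, j < n + n & paren_matched P i j \/ paren_matched P j i.
Proof.
elim: n P w i => [|n IH] P w i; first by [].
move=> [F [a [b [X [w' [_ cw -> _]]]]]] iN.
have [lP' _] := code_dyck_path cw; have szP' := lattice_path_size lP'.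
set Y := nseq a R ++ nseq b U ++ X in cw lP' szP' *.
have szP := size_peak F Y; have szF : size F <= size (F ++ Y) by rewrite size_cat leq_addr.
have peak : paren_matched (F ++ U :: R :: Y) (size F) (size F).+1.
  apply/paren_matchedP; first by lia.
  by split; rewrite ?nth_peakU ?nth_peakR ?dint_refl.
case: (eqVneq i (size F)) => [->|ni]; first by exists (size F).+1; [lia|left].
case: (eqVneq i (size F).+1) => [->|ni1]; first by exists (size F); [lia|right].
pose i' := if i < size F then i else i.-2.
have ei : i = skip2 (size F) i'.
  rewrite /skip2 /i'; case: (ltnP i (size F)) => h; first by rewrite h.
  have -> : i.-2 < size F = false by lia.
  by lia.
have i'n : i' < n + n by rewrite /i'; case: ifP; lia.
have lift p q : q < size (F ++ Y) -> paren_matched (F ++ Y) p q ->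
    paren_matched (F ++ U :: R :: Y) (skip2 (size F) p) (skip2 (size F) q).
  move=> qs /(paren_matchedP _ qs) [pq ep eq h].
  have qs2 : skip2 (size F) q < size (F ++ U :: R :: Y).
    by rewrite szP /skip2; case: ifP; lia.
  apply/paren_matchedP => //; split; rewrite ?nth_peak -?dint_peak //.
  by rewrite /skip2; case: ifP; case: ifP; lia.
have [j jn hj] := IH _ _ _ cw i'n.
exists (skip2 (size F) j); first by rewrite /skip2; case: ifP; lia.
by rewrite ei; case: hj => h; [left|right]; apply: lift h; lia.
Qed.

Lemma paren_matching_ex n P (w : 'S_n) : code P w ->
  exists m : {perm 'I_(n + n)}, paren_matching P m.
Proof.
move=> cw; have szP := lattice_path_size (code_dyck_path cw).1.
have ex (i : 'I_(n + n)) : exists j : 'I_(n + n),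
    paren_matched P i j \/ paren_matched P j i.
  have [j jn h] := partner_ex cw (ltn_ord i); by exists (Ordinal jn).
have [f fE] := fin_all_exists ex.
have lt (i : 'I_(n + n)) : i < size P by rewrite szP.
have [sU sR] : (forall p q, paren_matched P p q -> q < size P -> nth U P p = U) /\
    (forall p q, paren_matched P p q -> q < size P -> nth U P q = R).
  by split=> p q h qs; move/(paren_matchedP _ qs): h => [].
have f_inj : injective f.
  move=> i1 i2 e; apply: ord_inj; have := fE i1; have := fE i2; rewrite e.
  case=> h2 [] h1.
  - exact: paren_matched_uniql (lt _) h1 h2.
  - by have := sU _ _ h1 (lt _); rewrite (sR _ _ h2 (lt _)).
  - by have := sR _ _ h1 (lt _); rewrite (sU _ _ h2 (lt _)).
  - exact: paren_matched_uniqr (lt _) (lt _) h1 h2.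
by exists (perm f_inj) => i; rewrite permE.
Qed.

(** The pairs of the final matching are the images of the pairs of parentheses
    by the product [t] of the transpositions. *)
Lemma reads_off_act n P (w : 'S_n) L (m t : {perm 'I_(n + n)}) :
  size P = n + n -> paren_matching P m ->
  (forall x, t x = act L x :> nat) ->
  (forall p q, q < size P -> paren_matched P p q ->
    exists v : 'I_n, act L q = n + n - v.+1 /\ act L p = w v) ->
  reads_off (m ^ t)%g w.
Proof.
move=> szP pm tE hL k.
have lt (x : 'I_(n + n)) : x < size P by rewrite szP.
have ex : t (t^-1%g (rshift n k)) = rshift n k by rewrite permKV.
rewrite -{1}ex permJ; set x := t^-1%g _ in ex *.
have tx : act L x = n + k by rewrite -tE ex.
case: (pm x) => /(hL _ _ (lt _)) [v []]; rewrite -?tE.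
  by move=> _ e; have := ltn_ord (w v); rewrite -e ex /= ltnNge leq_addr.
rewrite ex /= => e1 e2; apply: ord_inj; rewrite e2 /=; congr (val (w _)).
by apply: ord_inj; have := ltn_ord v; move: e1 => /=; lia.
Qed.

Lemma reads_off_inj n (m : {perm 'I_(n + n)}) (v w : 'S_n) :
  reads_off m v -> reads_off m w -> v = w.
Proof.
move=> hv hw; apply/permP => i; rewrite -(rev_ordK i).
by apply: (@lshift_inj n n); rewrite -hv -hw.
Qed.

Lemma perm_eq_map (T T' : eqType) (f : T -> T') (s : seq T) (t : seq T') :
  perm_eq t (map f s) -> exists2 s', t = map f s' & perm_eq s s'.
Proof.
case: s => [|x s] pe; first by exists [::] => //; apply/perm_nilP.
have /(perm_iotaP (f x)) [Is pI ->] := pe; rewrite size_map in pI.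
exists [seq nth x (x :: s) i | i <- Is].
  rewrite -map_comp; apply/eq_in_map => i; rewrite (perm_mem pI) mem_iota => /andP [_ h].
  by rewrite (nth_map x).
rewrite perm_sym; apply/(perm_iotaP x); by exists Is.
Qed.

Theorem proposition5p9 (n : nat) (P : seq step) (hP : dyck_path n P) :
  exists w : 'S_n,
    unique (fun v : 'S_n => DT P v) w /\
    unique (fun v : 'S_n => avoids321 v /\ RSKhat v = P) w.
Proof.
have [w cw uw] := RSKhat_unique hP; exists w; split=> //.
have [lay [lay_ok pm]] := code_layers cw.
have lP := hP.1; have szP := lattice_path_size lP.
have fit := tiles_fit hP lay_ok; have cl := clears_tiles hP lay_ok.
set L := tiles lay (nR P n) in fit cl.
have eL : map snd L = all_moves lay (nR P n) by exact: tiles_moves.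
rewrite -eL in pm.
have pe : perm_eq (map (tile_cells n P) L) (enum (max_tiling n P lay)).
  apply: uniq_perm; first exact: (clears_uniq lP fit cl).
    exact: enum_uniq.
  by move=> d; rewrite mem_enum in_set.
split.
  have [m0 pm0] := paren_matching_ex cw.
  have [t tE run] := clears_run lP m0 lP fit cl.
  exists (max_tiling n P lay), (map (tile_cells n P) L), m0, (m0 ^ t)%g; split=> //.
    exact: (max_tiling_maximal hP lay_ok).
  exact: (reads_off_act szP pm0 tE pm).
move=> v [T [ds [m0 [m [mT peT pm0 run ro]]]]].
have eT := maximal_tiling_unique hP lay_ok mT; rewrite eT in peT.
have [L' eds peL] : exists2 L', ds = map (tile_cells n P) L' & perm_eq L L'.
  by apply: perm_eq_map; rewrite perm_sym (perm_trans pe) // perm_sym.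
rewrite eds in run.
have fit' e : e \in L' -> tile_fits n P e by rewrite -(perm_mem peL); apply: fit.
have [[B cl'] [t tE em]] := run_clears lP lP fit' run.
rewrite em in ro; apply: reads_off_inj _ ro.
apply: reads_off_act szP pm0 _ pm => x.
by rewrite tE (clears_act lP lP fit peL cl cl').
Qed.
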